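(* Let $(\bar\xi,\bar x)\in\operatorname{gph}E$ with $\bar\xi\in\Omega$ be a local solution to (MPEC), and let $\rho>0$. Suppose that: (i) $\varphi$ is locally Lipschitz around $(\bar\xi,\bar x)$; (ii) $K$ is continuous (lower and upper semicontinuous); (iii) $\widetilde\Omega$ and $\operatorname{gph}E$ are subtransversal at $(\bar\xi,\bar x)$; (iv) $f$ is $C$-u.s.c.; (v) $-\partial^\infty\nu(\bar\xi,\bar x)\cap\big(D^*K(\bar\xi,\bar x)(\mathbb B)\times\mathbb B\big)=\{0\}$; (vi) for every $\xi\in\mathbb B(\bar\xi,\rho)$ there exists $x_{0,\xi}\in K(\xi)$ such that $f(\xi,x_{0,\xi},K(\xi))$ is $C$-bounded; (vii) there exists $\gamma>0$ such that $$\big[\partial_x\nu(\xi,x)+N^\flat(x;K(\xi))\big]\cap\gamma\mathbb B=\emptyset\quad\forall x\in\mathbb R^n\setminus E(\xi),\ \forall\xi\in\mathbb B(\bar\xi,\rho).$$ Then there exists $\lambda>0$ such that $$0\in\partial\varphi(\bar\xi,\bar x)+\lambda\big[(N(\bar\xi;\Omega)\cap\mathbb B)\times\{0\}\big]+\frac{\lambda}{\gamma}\Big[\partial\nu(\bar\xi,\bar x)+\big(D^*K(\bar\xi,\bar x)(\mathbb B)\times\mathbb B\big)\Big].$$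
   Context: $C\subset\mathbb R^m$ nontrivial closed convex pointed cone; $f:\mathbb R^p\times\mathbb R^n\times\mathbb R^n\to\mathbb R^m$; $K:\mathbb R^p\rightrightarrows\mathbb R^n$ has closed graph and nonempty values everywhere. VEP($\xi$): find $x\in K(\xi)$ with $f(\xi,x,z)\in C$ for all $z\in K(\xi)$; $E(\xi)$ its solution set. $\nu(\xi,x)=\sup_{z\in K(\xi)}\operatorname{dist}(f(\xi,x,z),C)$, $\mu(\xi,x)=\operatorname{dist}(x,K(\xi))$, $\mathfrak m=\nu+\mu$. (MPEC): minimize $\varphi(\xi,x)$ s.t. $x\in E(\xi)$, $\xi\in\Omega$, with $\varphi:\mathbb R^p\times\mathbb R^n\to\mathbb R$, $\Omega\subseteq\mathbb R^p$ closed; $\widetilde\Omega=\Omega\times\mathbb R^n$. Subtransversality of $S_1,S_2$ at $\bar s$: there exist $\kappa,r>0$ with $\operatorname{dist}(w,S_1\cap S_2)\le\kappa\max\{\operatorname{dist}(w,S_1),\operatorname{dist}(w,S_2)\}$ for all $w\in\mathbb B(\bar s,r)$. $C$-u.s.c.: for every neighbourhood $V$ of $f(u_0)$ there is a neighbourhood $U$ of $u_0$ with $f(u)\in V-C$ on $U$. $S$ is $C$-bounded if $S\setminus C$ is bounded. $\Pi(x;S)$ Euclidean projection set; basic normal cone $N(\bar x;S)=\operatorname{Limsup}_{x\to\bar x}\operatorname{cone}[x-\Pi(x;S)]$; coderivative $D^*F(\bar x,\bar y)(v)=\{u:(u,-v)\in N((\bar x,\bar y);\operatorname{gph}F)\}$,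 $D^*F(\bar x,\bar y)(V)=\bigcup_{v\in V}D^*F(\bar x,\bar y)(v)$; basic subdifferential $\partial\psi(\bar x)=\{v:(v,-1)\in N((\bar x,\psi(\bar x));\operatorname{epi}\psi)\}$, singular subdifferential $\partial^\infty\psi(\bar x)=\{v:(v,0)\in N((\bar x,\psi(\bar x));\operatorname{epi}\psi)\}$; $\partial_x$ denotes the partial basic subdifferential in $x$. Unit truncation map: $N^\flat(x;K(\xi))=N(x;K(\xi))\cap\mathbb B$ if $x\in K(\xi)$, and $\{(x-z)/\operatorname{dist}(x,K(\xi)):z\in\Pi(x;K(\xi))\}$ otherwise. $\mathbb B$ closed unit ball (in the appropriate space). *)

(* Defs.v *)
From HB Require Import structures.
From mathcomp Require Import all_boot all_order all_algebra.
From mathcomp Require Import boolp classical_sets reals constructive_ereal ereal.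
Set Implicit Arguments. Unset Strict Implicit. Unset Printing Implicit Defensive.
Import Order.TTheory GRing.Theory Num.Theory.
Local Open Scope classical_set_scope.
Local Open Scope ring_scope.

Section Defs.
Variable R : realType.

Definition enorm k (v : 'rV[R]_k) : R := Num.sqrt (\sum_i (v ord0 i) ^+ 2).

Definition cball k (c : 'rV[R]_k) (r : R) : set 'rV[R]_k :=
  [set y | enorm (y - c) <= r].

Definition pr k l (a : 'rV[R]_k) (b : 'rV[R]_l) : 'rV[R]_(k + l) := row_mx a b.

Definition r1 (a : R) : 'rV[R]_1 := const_mx a.

Definition eopen k (S : set 'rV[R]_k) : Prop :=
  forall x, S x -> exists2 e, 0 < e & forall y, enorm (y - x) < e -> S y.

Definition eclosed k (S : set 'rV[R]_k) : Prop :=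
  forall x, (forall e, 0 < e -> exists2 s, S s & enorm (x - s) < e) -> S x.

Definition econv k (u : nat -> 'rV[R]_k) (l : 'rV[R]_k) : Prop :=
  forall e, 0 < e -> exists N, forall j, (N <= j)%N -> enorm (u j - l) < e.

Definition dist k (x : 'rV[R]_k) (S : set 'rV[R]_k) : R :=
  inf [set enorm (x - s) | s in S].

Definition proj k (x : 'rV[R]_k) (S : set 'rV[R]_k) : set 'rV[R]_k :=
  [set z | S z /\ forall s, S s -> enorm (x - z) <= enorm (x - s)].

Definition coneof k (A : set 'rV[R]_k) : set 'rV[R]_k :=
  [set v | exists t a, 0 <= t /\ A a /\ v = t *: a].

(* basic (limiting) normal cone; empty outside S (standard convention) *)
Definition ncone k (xb : 'rV[R]_k) (S : set 'rV[R]_k) : set 'rV[R]_k :=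
  [set v | S xb /\
     exists (x : nat -> 'rV[R]_k) (w : nat -> 'rV[R]_k),
       econv x xb /\ econv w v /\
       forall j, coneof [set x j - z | z in proj (x j) S] (w j)].

Definition gph p n (F : 'rV[R]_p -> set 'rV[R]_n) : set 'rV[R]_(p + n) :=
  [set w | exists a b, F a b /\ w = pr a b].

Definition coderiv p n (F : 'rV[R]_p -> set 'rV[R]_n) (xb : 'rV[R]_p)
  (yb : 'rV[R]_n) (v : 'rV[R]_n) : set 'rV[R]_p :=
  [set u | ncone (pr xb yb) (gph F) (pr u (- v))].

Definition coderiv_ball p n (F : 'rV[R]_p -> set 'rV[R]_n) (xb : 'rV[R]_p)
  (yb : 'rV[R]_n) : set 'rV[R]_p :=
  [set u | exists2 v, enorm v <= 1 & coderiv F xb yb v u].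

Definition epi k (psi : 'rV[R]_k -> \bar R) : set 'rV[R]_(k + 1) :=
  [set w | exists x a, (psi x <= a%:E)%E /\ w = pr x (r1 a)].

Definition subdiff k (psi : 'rV[R]_k -> \bar R) (xb : 'rV[R]_k) : set 'rV[R]_k :=
  [set v | psi xb \is a fin_num /\
           ncone (pr xb (r1 (fine (psi xb)))) (epi psi) (pr v (r1 (-1)))].

Definition subdiff_inf k (psi : 'rV[R]_k -> \bar R) (xb : 'rV[R]_k) : set 'rV[R]_k :=
  [set v | psi xb \is a fin_num /\
           ncone (pr xb (r1 (fine (psi xb)))) (epi psi) (pr v (r1 0))].

Definition uncurry2 p n T (g : 'rV[R]_p -> 'rV[R]_n -> T) : 'rV[R]_(p + n) -> T :=
  fun w => g (lsubmx w) (rsubmx w).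

Definition solE p n m (C : set 'rV[R]_m)
  (f : 'rV[R]_p -> 'rV[R]_n -> 'rV[R]_n -> 'rV[R]_m)
  (K : 'rV[R]_p -> set 'rV[R]_n) (xi : 'rV[R]_p) : set 'rV[R]_n :=
  [set x | K xi x /\ forall z, K xi z -> C (f xi x z)].

Definition nu p n m (C : set 'rV[R]_m)
  (f : 'rV[R]_p -> 'rV[R]_n -> 'rV[R]_n -> 'rV[R]_m)
  (K : 'rV[R]_p -> set 'rV[R]_n) (xi : 'rV[R]_p) (x : 'rV[R]_n) : \bar R :=
  ereal_sup [set (dist (f xi x z) C)%:E | z in K xi].

Definition ncone_flat k (x : 'rV[R]_k) (S : set 'rV[R]_k) : set 'rV[R]_k :=
  if `[< S x >] then ncone x S `&` cball 0 1
  else [set (dist x S)^-1 *: (x - z) | z in proj x S].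

Definition closed_convex_pointed_cone m (C : set 'rV[R]_m) : Prop :=
  eclosed C /\ C <> set0 /\ C <> [set 0] /\
  (forall c t, C c -> 0 <= t -> C (t *: c)) /\
  (forall a b t, C a -> C b -> 0 <= t <= 1 -> C (t *: a + (1 - t) *: b)) /\
  (forall c, C c -> C (- c) -> c = 0).

Definition lsc_map p n (K : 'rV[R]_p -> set 'rV[R]_n) : Prop :=
  forall xi0 (V : set 'rV[R]_n), eopen V -> K xi0 `&` V !=set0 ->
    exists2 d, 0 < d & forall xi, enorm (xi - xi0) < d -> K xi `&` V !=set0.

Definition usc_map p n (K : 'rV[R]_p -> set 'rV[R]_n) : Prop :=
  forall xi0 (V : set 'rV[R]_n), eopen V -> K xi0 `<=` V ->
    exists2 d, 0 < d & forall xi, enorm (xi - xi0) < d -> K xi `<=` V.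

Definition C_usc p n m (C : set 'rV[R]_m)
  (f : 'rV[R]_p -> 'rV[R]_n -> 'rV[R]_n -> 'rV[R]_m) : Prop :=
  forall xi0 x0 z0 (V : set 'rV[R]_m), eopen V -> V (f xi0 x0 z0) ->
    exists2 d, 0 < d & forall xi x z,
      enorm (pr (pr (xi - xi0) (x - x0)) (z - z0)) < d ->
      exists v c, V v /\ C c /\ f xi x z = v - c.

Definition C_bounded m (C : set 'rV[R]_m) (S : set 'rV[R]_m) : Prop :=
  exists M, forall y, S y -> ~ C y -> enorm y <= M.

Definition subtransversal k (S1 S2 : set 'rV[R]_k) (sb : 'rV[R]_k) : Prop :=
  exists kappa r, 0 < kappa /\ 0 < r /\
    forall w, cball sb r w ->
      dist w (S1 `&` S2) <= kappa * Num.max (dist w S1) (dist w S2).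

Definition loc_lipschitz k (g : 'rV[R]_k -> R) (wb : 'rV[R]_k) : Prop :=
  exists L r, 0 < r /\ forall w1 w2, cball wb r w1 -> cball wb r w2 ->
    `|g w1 - g w2| <= L * enorm (w1 - w2).

End Defs.

(* Main.v *)
(* Condition (vii) gives, on a neighbourhood of xib, the error bound
   gamma * dist(x, E(xi)) <= nu(xi, x) + mu(xi, x): a minimizer of
   nu(xi, .) + mu(xi, .) + gamma |. - x0| outside E(xi) would have a subgradient
   of norm at most gamma excluded by (vii).  Together with subtransversality and
   exact penalization, (xib, xb) becomes an unconstrained local minimizer of
   (gamma / lambda) phi + gamma dist(., Omega~) + nu + mu.  Decoupling the four
   variables by a quadratic penalty yields proximal subgradients at nearby points
   whose sum tends to zero.  Those of phi and of the distance to Omega~ are bounded;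
   if those of nu were unbounded, their normalized limit would be a nonzero
   singular subgradient contradicting (v).  Otherwise the limits give the claim.
   Compactness is used through limits along an ultrafilter on nat, so that no
   subsequences have to be extracted. *)
Require Import Defs.
From HB Require Import structures.
From mathcomp Require Import all_boot all_order all_algebra.
From mathcomp Require Import boolp classical_sets reals constructive_ereal ereal.
From mathcomp Require Import filter topology normedtype.
From mathcomp Require Import ring lra.
Import Order.TTheory GRing.Theory Num.Theory.
Import numFieldTopology.Exports numFieldNormedType.Exports.
Local Open Scope classical_set_scope.
Local Open Scope ring_scope.
Set Implicit Arguments. Unset Strict Implicit. Unset Printing Implicit Defensive.

(** * Euclidean norm and distance *)

Section Vectors.
Variable R : realType.
Implicit Types k l : nat.

(** The obstacle is that neither nu nor mu need be Lipschitz near [(xib, xb)], and nu may take the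
    value +oo, so no exact sum rule applies directly. Functions are therefore handled through closed
    epigraph relations, with the height as an extra variable; the fuzzy sum rule then asks only for
    lower semicontinuity and local lower bounds. What remains of Lipschitz behaviour for mu is in x
    alone: the x-part of its subgradients has norm at most 1, whereas the xi-part is uncontrolled.
    Since the subgradients of nu and mu have a convergent sum, they are bounded together or
    unbounded together. After division by the norms of those of nu, the x-part on the mu side
    vanishes in the limit, so the limit lies in the coderivative of K at 0, and this is where (v)
    applies. The multiplier is lambda = L kappa, with L a Lipschitz constant of phi and kappa the
    constant of subtransversality. Scaling phi by gamma / lambda leaves nu and mu with coefficient
    one. *)

Definition dot k (u v : 'rV[R]_k) : R := \sum_i u ord0 i * v ord0 i.

Lemma dotC k (u v : 'rV[R]_k) : dot u v = dot v u.
Proof. by apply: eq_bigr => i _; rewrite mulrC. Qed.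

Lemma dotDl k (u v w : 'rV[R]_k) : dot (u + v) w = dot u w + dot v w.
Proof. by rewrite -big_split; apply: eq_bigr => i _; rewrite !mxE mulrDl. Qed.

Lemma dotZl k a (u w : 'rV[R]_k) : dot (a *: u) w = a * dot u w.
Proof. by rewrite mulr_sumr; apply: eq_bigr => i _; rewrite !mxE mulrA. Qed.

Lemma dotNl k (u w : 'rV[R]_k) : dot (- u) w = - dot u w.
Proof. by rewrite -scaleN1r dotZl mulN1r. Qed.

Lemma dotBl k (u v w : 'rV[R]_k) : dot (u - v) w = dot u w - dot v w.
Proof. by rewrite dotDl dotNl. Qed.

Lemma dotDr k (u v w : 'rV[R]_k) : dot w (u + v) = dot w u + dot w v.
Proof. by rewrite dotC dotDl !(dotC w). Qed.

Lemma dotZr k a (u w : 'rV[R]_k) : dot w (a *: u) = a * dot w u.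
Proof. by rewrite dotC dotZl (dotC w). Qed.

Lemma dotNr k (u w : 'rV[R]_k) : dot w (- u) = - dot w u.
Proof. by rewrite dotC dotNl (dotC w). Qed.

Lemma dotBr k (u v w : 'rV[R]_k) : dot w (u - v) = dot w u - dot w v.
Proof. by rewrite dotDr dotNr. Qed.

Lemma dot_sumr k (I : finType) (u : I -> 'rV[R]_k) w :
  dot w (\sum_i u i) = \sum_i dot w (u i).
Proof.
elim/big_rec2: _ => [|i y x _ <-]; last by rewrite dotDr.
by rewrite /dot big1 // => i _; rewrite mxE mulr0.
Qed.

Lemma dot_ge0 k (u : 'rV[R]_k) : 0 <= dot u u.
Proof. by apply: sumr_ge0 => i _; rewrite -expr2 sqr_ge0. Qed.

Lemma enorm_ge0 k (u : 'rV[R]_k) : 0 <= enorm u.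
Proof. exact: sqrtr_ge0. Qed.

Lemma enorm_sqr k (u : 'rV[R]_k) : enorm u ^+ 2 = dot u u.
Proof.
rewrite sqr_sqrtr; first by apply: eq_bigr => i _; rewrite expr2.
by apply: sumr_ge0 => i _; rewrite sqr_ge0.
Qed.

Lemma enorm_eq0 k (u : 'rV[R]_k) : enorm u = 0 -> u = 0.
Proof.
move=> u0; have := enorm_sqr u; rewrite u0 expr0n /= => /esym /eqP.
rewrite psumr_eq0 => [|i _]; last by rewrite -expr2 sqr_ge0.
move/allP => h; apply/rowP => i; rewrite mxE.
by have := h i (mem_index_enum _); rewrite /= mulf_eq0 orbb => /eqP.
Qed.

Lemma enorm_sqr_le0 k (u : 'rV[R]_k) : enorm u ^+ 2 <= 0 -> u = 0.
Proof.
move=> h; apply: enorm_eq0; apply/eqP.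
have : enorm u ^+ 2 == 0 by rewrite eq_le h sqr_ge0.
by rewrite expf_eq0.
Qed.

Lemma enormZ k a (u : 'rV[R]_k) : enorm (a *: u) = `|a| * enorm u.
Proof.
apply: (@pexpIrn _ 2) => //; rewrite ?nnegrE ?mulr_ge0 ?enorm_ge0 //.
by rewrite exprMn !enorm_sqr dotZl dotZr real_normK ?num_real // expr2 mulrA.
Qed.

Lemma enorm0 k : enorm (0 : 'rV[R]_k) = 0.
Proof. by rewrite -(scale0r 0) enormZ normr0 mul0r. Qed.

Lemma enormN k (u : 'rV[R]_k) : enorm (- u) = enorm u.
Proof. by rewrite -scaleN1r enormZ normrN1 mul1r. Qed.

Lemma enormBC k (u v : 'rV[R]_k) : enorm (u - v) = enorm (v - u).
Proof. by rewrite -enormN opprB. Qed.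

Lemma dot_le k (u v : 'rV[R]_k) : dot u v <= enorm u * enorm v.
Proof.
have [v0|v0] := eqVneq (enorm v) 0.
  by rewrite (enorm_eq0 v0) enorm0 mulr0 /dot big1 // => i _; rewrite mxE mulr0.
have vp : 0 < enorm v by rewrite lt_def v0 enorm_ge0.
(* Cauchy-Schwarz: this vector is the part of [u] orthogonal to [v], multiplied by the squared norm
   of [v] to avoid a division. *)
have := dot_ge0 (dot v v *: u - dot u v *: v).
rewrite !(dotBl, dotBr, dotZl, dotZr) (dotC v u).
set c := dot u v; rewrite -!enorm_sqr.
set a := enorm u; set b := enorm v => h.
have {}h : 0 <= b ^+ 2 * ((a * b) ^+ 2 - c ^+ 2).
  by apply: (le_trans h); rewrite le_eqVlt; apply/orP; left; apply/eqP; ring.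
rewrite pmulr_rge0 ?exprn_gt0 // subr_ge0 in h.
have ab : 0 <= a * b by rewrite mulr_ge0 // enorm_ge0.
have [c0|c0] := leP c 0; first exact: le_trans c0 ab.
by rewrite -(@ler_pXn2r _ 2) ?nnegrE // ltW.
Qed.

Lemma enormD k (u v : 'rV[R]_k) : enorm (u + v) <= enorm u + enorm v.
Proof.
rewrite -(@ler_pXn2r _ 2) ?nnegrE ?addr_ge0 ?enorm_ge0 //.
rewrite enorm_sqr dotDl !dotDr (dotC v u) -!enorm_sqr.
by have := dot_le u v; lra.
Qed.

Lemma enorm_tri k (w u v : 'rV[R]_k) : enorm (u - v) <= enorm (u - w) + enorm (w - v).
Proof. by have := enormD (u - w) (w - v); rewrite addrA subrK. Qed.

Lemma enorm_sqrB k (u v : 'rV[R]_k) :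
  enorm (u - v) ^+ 2 = enorm u ^+ 2 - 2 * dot u v + enorm v ^+ 2.
Proof. by rewrite !enorm_sqr !(dotBl, dotBr) (dotC v u); ring. Qed.

Lemma enorm_le_eps k (u : 'rV[R]_k) : (forall e, 0 < e -> enorm u <= e) -> u = 0.
Proof.
move=> h; apply: enorm_eq0; apply/eqP; rewrite eq_le enorm_ge0 andbT.
by apply/ler_addgt0Pr => e e0; rewrite add0r h.
Qed.

Lemma dot_pr k l (a c : 'rV[R]_k) (b d : 'rV[R]_l) :
  dot (pr a b) (pr c d) = dot a c + dot b d.
Proof.
by rewrite /dot /pr big_split_ord; congr (_ + _); apply: eq_bigr => i _;
  rewrite ?row_mxEl ?row_mxEr.
Qed.

Lemma enorm_pr k l (a : 'rV[R]_k) (b : 'rV[R]_l) :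
  enorm (pr a b) ^+ 2 = enorm a ^+ 2 + enorm b ^+ 2.
Proof. by rewrite !enorm_sqr dot_pr. Qed.

Lemma enorm_prl k l (a : 'rV[R]_k) (b : 'rV[R]_l) : enorm a <= enorm (pr a b).
Proof.
rewrite -(@ler_pXn2r _ 2) ?nnegrE ?enorm_ge0 // enorm_pr.
by rewrite lerDl sqr_ge0.
Qed.

Lemma enorm_prr k l (a : 'rV[R]_k) (b : 'rV[R]_l) : enorm b <= enorm (pr a b).
Proof.
rewrite -(@ler_pXn2r _ 2) ?nnegrE ?enorm_ge0 // enorm_pr.
by rewrite lerDr sqr_ge0.
Qed.

Lemma enorm_pr_le k l (a : 'rV[R]_k) (b : 'rV[R]_l) :
  enorm (pr a b) <= enorm a + enorm b.
Proof.
rewrite -(@ler_pXn2r _ 2) ?nnegrE ?addr_ge0 ?enorm_ge0 // enorm_pr.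
by have := mulr_ge0 (enorm_ge0 a) (enorm_ge0 b); lra.
Qed.

Lemma enorm_pr0r k l (a : 'rV[R]_k) : enorm (pr a (0 : 'rV[R]_l)) = enorm a.
Proof.
by apply/eqP; rewrite eq_le enorm_prl andbT (le_trans (enorm_pr_le _ _)) // enorm0 addr0.
Qed.

Lemma enorm_pr0l k l (b : 'rV[R]_l) : enorm (pr (0 : 'rV[R]_k) b) = enorm b.
Proof.
by apply/eqP; rewrite eq_le enorm_prr andbT (le_trans (enorm_pr_le _ _)) // enorm0 add0r.
Qed.

Lemma enorm_r1 (a : R) : enorm (r1 a) = `|a|.
Proof. by rewrite /enorm big_ord1 mxE sqrtr_sqr. Qed.

Lemma dot_r1 (a b : R) : dot (r1 a) (r1 b) = a * b.
Proof. by rewrite /dot big_ord1 !mxE. Qed.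

Lemma prB k l (a c : 'rV[R]_k) (b d : 'rV[R]_l) : pr a b - pr c d = pr (a - c) (b - d).
Proof. by rewrite /pr opp_row_mx add_row_mx. Qed.

Lemma prD k l (a c : 'rV[R]_k) (b d : 'rV[R]_l) : pr a b + pr c d = pr (a + c) (b + d).
Proof. by rewrite /pr add_row_mx. Qed.

Lemma prZ k l t (a : 'rV[R]_k) (b : 'rV[R]_l) : t *: pr a b = pr (t *: a) (t *: b).
Proof. by rewrite /pr scale_row_mx. Qed.

Lemma r1B (a b : R) : r1 a - r1 b = r1 (a - b).
Proof. by apply/rowP => i; rewrite !mxE. Qed.

Lemma r1Z (t a : R) : t *: r1 a = r1 (t * a).
Proof. by apply/rowP => i; rewrite !mxE. Qed.

Lemma pr_eta k l (w : 'rV[R]_(k + l)) : w = pr (lsubmx w) (rsubmx w).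
Proof. by rewrite /pr hsubmxK. Qed.

Lemma lsubmx_pr k l (a : 'rV[R]_k) (b : 'rV[R]_l) : lsubmx (pr a b) = a.
Proof. exact: row_mxKl. Qed.

Lemma rsubmx_pr k l (a : 'rV[R]_k) (b : 'rV[R]_l) : rsubmx (pr a b) = b.
Proof. exact: row_mxKr. Qed.

Lemma enorm_lsubmx k l (w : 'rV[R]_(k + l)) : enorm (lsubmx w) <= enorm w.
Proof. by rewrite {2}(pr_eta w) enorm_prl. Qed.

Lemma dist_le k (x s : 'rV[R]_k) S : S s -> dist x S <= enorm (x - s).
Proof.
move=> Ss; apply: ge_inf; last by exists s.
by exists 0 => _ [t _ <-]; apply: enorm_ge0.
Qed.

Lemma le_dist k (x : 'rV[R]_k) (S : set 'rV[R]_k) c : S !=set0 ->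
  (forall s, S s -> c <= enorm (x - s)) -> c <= dist x S.
Proof.
move=> [s0 Ss0] h; apply: lb_le_inf; first by exists (enorm (x - s0)), s0.
by move=> _ [t St <-]; apply: h.
Qed.

Lemma dist_ge0 k (x : 'rV[R]_k) (S : set 'rV[R]_k) : S !=set0 -> 0 <= dist x S.
Proof. by move=> S0; apply: le_dist => // s _; apply: enorm_ge0. Qed.

Lemma dist_approx k (x : 'rV[R]_k) (S : set 'rV[R]_k) e : S !=set0 -> 0 < e ->
  exists2 s, S s & enorm (x - s) < dist x S + e.
Proof.
move=> S0 e0; apply: contrapT => h.
have : dist x S + e <= dist x S.
  apply: le_dist => // s Ss; rewrite leNgt; apply/negP => lt.
  by apply: h; exists s.
by rewrite gerDl leNgt e0.
Qed.

Lemma dist_lip k (x y : 'rV[R]_k) (S : set 'rV[R]_k) : S !=set0 ->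
  dist x S <= dist y S + enorm (x - y).
Proof.
move=> S0; rewrite -lerBlDr; apply: le_dist => // s Ss.
rewrite lerBlDr addrC; apply: le_trans (enorm_tri y _ _).
exact: dist_le.
Qed.

Lemma dist_eq0 k (x : 'rV[R]_k) (S : set 'rV[R]_k) : S x -> dist x S = 0.
Proof.
move=> Sx; apply/eqP; rewrite eq_le dist_ge0; last by exists x.
by have := dist_le x Sx; rewrite subrr enorm0 => ->.
Qed.

Lemma dist_proj k (x y : 'rV[R]_k) (S : set 'rV[R]_k) : proj x S y -> dist x S = enorm (x - y).
Proof.
move=> [Sy h]; apply/eqP; rewrite eq_le dist_le //=.
by apply: le_dist; first by exists y.
Qed.

Lemma dist_le0 k (x : 'rV[R]_k) (S : set 'rV[R]_k) : eclosed S -> S !=set0 ->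
  dist x S <= 0 -> S x.
Proof.
move=> Sc S0 d0; apply: Sc => e e0; have [s Ss lt] := dist_approx x S0 e0.
by exists s => //; apply: lt_le_trans lt _; rewrite gerDr.
Qed.

End Vectors.

(** * Limits along an ultrafilter *)

Lemma exists_ultra_infty : exists U : set_system nat, UltraFilter U /\ \oo `<=` U.
Proof. exact: ultraFilterLemma. Qed.

Section UltraLimits.
Variables (R : realType) (U : set_system nat).
Hypothesis UU : UltraFilter U.
Implicit Types (k : nat).

(** Stated through a real limit because distances are measured by [enorm], whereas the built-in norm
    on row vectors is the maximum norm. *)
Definition vcv k (u : nat -> 'rV[R]_k) (l : 'rV[R]_k) :=
  enorm (u j - l) @[j --> U] --> (0 : R).

Lemma vcvP k (u : nat -> 'rV[R]_k) l :
  vcv u l <-> forall e, 0 < e -> \forall j \near U, enorm (u j - l) < e.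
Proof.
split=> [/cvgr0Pnorm_lt h e /h|h].
  by apply: filterS => j; rewrite ger0_norm ?enorm_ge0.
by apply/cvgr0Pnorm_lt => e /h; apply: filterS => j; rewrite ger0_norm ?enorm_ge0.
Qed.

Lemma vcv_le k (u : nat -> 'rV[R]_k) l (g : nat -> R) :
  (\forall j \near U, enorm (u j - l) <= g j) -> g j @[j --> U] --> (0 : R) -> vcv u l.
Proof.
move=> h g0; apply: (@squeeze_cvgr _ U _ _ (fun=> 0) g) => //; last exact: cvg_cst.
by apply: filterS h => j ->; rewrite enorm_ge0.
Qed.

Lemma vcv_ext k (u v : nat -> 'rV[R]_k) l : (forall j, u j = v j) -> vcv u l -> vcv v l.
Proof. by move=> /funext ->. Qed.

Lemma vcv_cst k (l : 'rV[R]_k) : vcv (fun=> l) l.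
Proof. by rewrite /vcv subrr enorm0; apply: cvg_cst. Qed.

Lemma vcvD k (u v : nat -> 'rV[R]_k) l m : vcv u l -> vcv v m ->
  vcv (fun j => u j + v j) (l + m).
Proof.
move=> hu hv; apply: (@vcv_le _ _ _ (fun j => enorm (u j - l) + enorm (v j - m))).
  by near=> j; rewrite opprD addrACA enormD.
by rewrite -[X in _ --> X]addr0; apply: cvgD.
Unshelve. all: by end_near. Qed.

Lemma vcvZ k (c : nat -> R) (u : nat -> 'rV[R]_k) (a : R) l :
  c j @[j --> U] --> a -> vcv u l -> vcv (fun j => c j *: u j) (a *: l).
Proof.
move=> hc hu.
apply: (@vcv_le _ _ _ (fun j => `|c j| * enorm (u j - l) + `|c j - a| * enorm l)).
  near=> j; rewrite -!enormZ.
  have -> : c j *: u j - a *: l = c j *: (u j - l) + (c j - a) *: l.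
    by rewrite scalerBr scalerBl addrA subrK.
  exact: enormD.
have -> : (0 : R) = `|a| * 0 + `|a - a| * enorm l by rewrite subrr normr0 mul0r mulr0 addr0.
apply: cvgD; first by apply: cvgM => //; apply: cvg_norm.
apply: cvgM; last exact: cvg_cst.
by apply: cvg_norm; apply: cvgB => //; apply: cvg_cst.
Unshelve. all: by end_near. Qed.

Lemma vcvN k (u : nat -> 'rV[R]_k) l : vcv u l -> vcv (fun j => - u j) (- l).
Proof.
move=> h; apply: (@vcv_le _ _ _ (fun j => enorm (u j - l))) => //.
by near=> j; rewrite -opprD enormN.
Unshelve. all: by end_near. Qed.

Lemma vcvB k (u v : nat -> 'rV[R]_k) l m : vcv u l -> vcv v m ->
  vcv (fun j => u j - v j) (l - m).
Proof. by move=> hu /vcvN; apply: vcvD. Qed.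

Lemma vcv_norm k (u : nat -> 'rV[R]_k) l : vcv u l -> enorm (u j) @[j --> U] --> enorm l.
Proof.
move=> h; apply/cvgrPdist_lt => e /((vcvP _ _).1 h); apply: filterS => j.
apply: le_lt_trans; rewrite ler_norml.
have h1 := enorm_tri (u j) l 0; have h2 := enorm_tri l (u j) 0.
by rewrite !subr0 in h1 h2; rewrite (enormBC l) in h1; apply/andP; split; lra.
Qed.

Lemma vcv_norm_le k (u : nat -> 'rV[R]_k) l M : vcv u l ->
  (\forall j \near U, enorm (u j) <= M) -> enorm l <= M.
Proof. by move=> /vcv_norm; apply: cvgr_to_le. Qed.

Lemma cvgr_sum (I : finType) (u : I -> nat -> R) (l : I -> R) :
  (forall i, u i j @[j --> U] --> l i) -> (\sum_i u i j) @[j --> U] --> \sum_i l i.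
Proof.
move=> h; elim: (index_enum I) => [|i s IH].
  by rewrite big_nil; under eq_fun do rewrite big_nil; apply: cvg_cst.
by rewrite big_cons; under eq_fun do rewrite big_cons; apply: cvgD.
Qed.

(** Compactness of the segment gives a cluster point, and an ultrafilter converges to each of its
    cluster points: if the preimage of a neighbourhood is not in [U], that of the complement is. *)
Lemma ultra_cvg_bounded (u : nat -> R) M :
  (\forall j \near U, `|u j| <= M) -> exists l : R, u j @[j --> U] --> l.
Proof.
move=> h; have := @segment_compact R (- M) M (u @ U) _ _.
case; first by apply: filterS h => j; rewrite /= in_itv /= ler_norml.
move=> l [_ hl]; exists l => B Bl.
have [//|nB] := in_ultra_setVsetC (u @^-1` B) UU.
by have [x [nBx /nBx]] := hl (~` B) B nB Bl.
Qed.

Lemma enorm_coord k (u : 'rV[R]_k) i : `|u ord0 i| <= enorm u.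
Proof.
rewrite -(@ler_pXn2r _ 2) ?nnegrE ?enorm_ge0 // real_normK ?num_real //.
rewrite enorm_sqr /dot (bigD1 i) //= expr2 lerDl.
by apply: sumr_ge0 => j _; rewrite -expr2 sqr_ge0.
Qed.

Lemma enorm_le_sum k (u : 'rV[R]_k) : enorm u <= \sum_i `|u ord0 i|.
Proof.
have s0 : 0 <= \sum_i `|u ord0 i| by apply: sumr_ge0.
rewrite -(@ler_pXn2r _ 2) ?nnegrE ?enorm_ge0 //.
rewrite enorm_sqr expr2 mulr_suml; apply: ler_sum => i _.
rewrite -expr2 -real_normK ?num_real // expr2.
apply: ler_wpM2l => //; rewrite (bigD1 i) //= lerDl.
exact: sumr_ge0.
Qed.

Lemma vcv_bounded k (u : nat -> 'rV[R]_k) M :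
  (\forall j \near U, enorm (u j) <= M) -> exists l, vcv u l.
Proof.
move=> h.
have /choice [l hl] : forall i, exists l : R, u j ord0 i @[j --> U] --> l.
  by move=> i; apply: (@ultra_cvg_bounded _ M); apply: filterS h => j;
    apply: le_trans; apply: enorm_coord.
exists (\row_i l i); apply: (@vcv_le _ _ _ (fun j => \sum_i `|u j ord0 i - l i|)).
  near=> j; apply: le_trans (enorm_le_sum _) _.
  by under eq_bigr do rewrite !mxE.
rewrite [X in _ --> X](_ : _ = \sum_i `|l i - l i|); last first.
  by rewrite big1 // => i _; rewrite subrr normr0.
apply: (@cvgr_sum _ (fun i j => `|u j ord0 i - l i|) (fun i => `|l i - l i|)) => i.
by apply: cvg_norm; apply: cvgB => //; apply: cvg_cst.
Unshelve. all: by end_near. Qed.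

(** An ultrafilter contains each sublevel set or its complement, so the failure of every bound is
    divergence along [U] itself, not just along a subsequence. *)
Lemma ultra_bounded_or (u : nat -> R) :
  (exists M, \forall j \near U, u j <= M) \/ (forall M, \forall j \near U, M < u j).
Proof.
have [?|h] := pselect (exists M, \forall j \near U, u j <= M); [by left|right=> M].
have [h1|] := in_ultra_setVsetC [set j | u j <= M] UU; first by case: h; exists M.
by apply: filterS => j /=; rewrite ltNge => /negP.
Qed.

Hypothesis Uoo : \oo `<=` U.

Lemma cvg_invSn : (j.+1%:R^-1 : R) @[j --> U] --> (0 : R).
Proof.
apply/cvgr0Pnorm_lt => e e0; apply: Uoo.
exists (Num.truncn e^-1) => // j /= hj.
rewrite ger0_norm ?invr_ge0 // invf_plt ?posrE //.
have e1 : 0 <= e^-1 by rewrite invr_ge0 ltW.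
have /andP[_ h] := truncn_itv e1.
by apply: lt_le_trans h _; rewrite ler_nat.
Qed.

Lemma invSn_gt0 (j : nat) : (0 : R) < j.+1%:R^-1.
Proof. by rewrite invr_gt0. Qed.

(** Direct method. The last hypothesis packs compactness, closedness of [D] and lower semicontinuity
    into one: along a minimizing sequence some point of [D] must do at least as well as the limit
    value. The bound [M] is what callers use to bound the sequence. *)
Lemma exists_min (T : Type) (D : set T) (F : T -> R) (b : R) P0 :
  D P0 -> (forall P, D P -> b <= F P) ->
  (forall (u : nat -> T) (c M : R), (forall j, D (u j)) -> (forall j, F (u j) <= M) ->
     F (u j) @[j --> U] --> c -> exists2 P, D P & F P <= c) ->
  exists2 P, D P & forall Q, D Q -> F P <= F Q.
Proof.
move=> D0 Fb comp; set A := [set F P | P in D]; set I := inf A.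
have hA : has_inf A.
  by split; [exists (F P0), P0 | exists b => _ [P DP <-]; apply: Fb].
have hI P : D P -> I <= F P by move=> DP; apply: ge_inf; [exact: hA.2 | exists P].
have /choice [u hu] : forall j : nat, exists P, D P /\ F P < I + j.+1%:R^-1.
  by move=> j; have [_ [P DP <-] lt] := inf_adherent (invSn_gt0 j) hA; exists P.
have [P DP hP] : exists2 P, D P & F P <= I; last first.
  by exists P => // Q /hI; apply: le_trans.
apply: (comp u I (I + 1)).
- by move=> j; case: (hu j).
- move=> j; case: (hu j) => _ /ltW /le_trans; apply.
  by rewrite lerD2l invf_le1 // ler1n.
- apply: (@squeeze_cvgr _ U _ _ (fun=> I) (fun j => I + j.+1%:R^-1)).
  + by near=> j; case: (hu j) => Dj lt; rewrite hI //= ltW.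
  + exact: cvg_cst.
  + by rewrite -[X in _ --> X]addr0; apply: cvgD; [exact: cvg_cst | exact: cvg_invSn].
Unshelve. all: by end_near. Qed.

Lemma vcv_closed k (S : set 'rV[R]_k) (u : nat -> 'rV[R]_k) l : eclosed S ->
  (\forall j \near U, S (u j)) -> vcv u l -> S l.
Proof.
move=> Sc Su /vcvP h; apply: Sc => e /h he.
have [j [Sj lt]] := filter_ex (filterI Su he).
by exists (u j) => //; rewrite enormBC.
Qed.

Lemma vcv_near_bounded k (u : nat -> 'rV[R]_k) l : vcv u l ->
  \forall j \near U, enorm (u j) <= enorm l + 1.
Proof.
move=> /vcvP /(_ _ ltr01); apply: filterS => j lt.
have := enorm_tri l (u j) 0; rewrite !subr0; lra.
Qed.

Lemma exists_proj k (x : 'rV[R]_k) S : eclosed S -> S !=set0 -> proj x S !=set0.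
Proof.
move=> Sc [s0 Ss0].
have [y Sy hy] : exists2 y, S y & forall s, S s -> enorm (x - y) <= enorm (x - s).
  apply: (@exists_min _ S (fun s => enorm (x - s)) 0 s0) => //.
    by move=> P _; apply: enorm_ge0.
  move=> u c M Su uM hc; have [l hl] : exists l, vcv u l.
    apply: (@vcv_bounded _ _ (enorm x + M)); near=> j.
    have := enorm_tri x (u j) 0; rewrite !subr0 (enormBC _ x).
    by have := uM j; lra.
  exists l; first by apply: vcv_closed Sc _ hl; near=> j; apply: Su.
  have := vcv_norm (vcvB (vcv_cst x) hl) => h.
  by rewrite (cvg_unique _ h hc) //; apply: norm_hausdorff.
by exists y; split.
Unshelve. all: by end_near. Qed.

End UltraLimits.

(** * Proximal normals and subgradients *)

Section Proximal.
Variable R : realType.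
Implicit Types k l : nat.

(** The inequality is local, as comparisons at a constrained minimizer are; [prox_normal_proj]
    recovers the projections on which [ncone] is built. *)
Definition prox_normal k (S : set 'rV[R]_k) (s v : 'rV[R]_k) : Prop :=
  S s /\ exists sg d, 0 < d /\ forall s', S s' -> enorm (s' - s) <= d ->
    dot v (s' - s) <= sg * enorm (s' - s) ^+ 2.

(* [S] stands for the epigraph of an extended-real function, as a relation. *)
Definition prox_subgrad k (S : 'rV[R]_k -> R -> Prop) (w : 'rV[R]_k) (a : R)
    (v : 'rV[R]_k) : Prop :=
  S w a /\ exists sg d, 0 < d /\ forall w' a', S w' a' -> enorm (w' - w) <= d ->
    dot v (w' - w) <= (a' - a) + sg * enorm (w' - w) ^+ 2.

Lemma le_linear_error (d A B C : R) : 0 < d ->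
  (forall t, 0 < t -> t < d -> A <= B + t * C) -> A <= B.
Proof.
move=> d0 h; apply/ler_addgt0Pr => e e0.
have C1 : 0 < `|C| + 1 by rewrite ltr_wpDl.
set t := Num.min (d / 2) (e / (`|C| + 1)).
have t0 : 0 < t by rewrite lt_min !divr_gt0.
have td : t < d by rewrite gt_min; apply/orP; left; lra.
apply: (le_trans (h t t0 td)); rewrite lerD2l.
have te : t <= e / (`|C| + 1) by rewrite ge_min lexx orbT.
rewrite ler_pdivlMr // in te; apply: le_trans te.
rewrite ler_wpM2l ?(ltW t0) //; have := ler_norm C; lra.
Qed.

Lemma prox_normal_scale k (S : set 'rV[R]_k) s v t :
  0 <= t -> prox_normal S s v -> prox_normal S s (t *: v).
Proof.
move=> t0 [Ss [sg [d [d0 h]]]]; split=> //; exists (t * sg), d; split=> // s' Ss' le.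
by rewrite dotZl -mulrA ler_wpM2l // h.
Qed.

(** Insert [w + t *: h], divide by [t] and let [t] tend to 0: the quadratic term disappears. *)
Lemma prox_subgrad_dir k (S : 'rV[R]_k -> R -> Prop) w a v h c d :
  prox_subgrad S w a v -> 0 < d ->
  (forall t, 0 < t -> t < d -> S (w + t *: h) (a + t * c)) -> dot v h <= c.
Proof.
move=> [Ss [sg [d1 [d10 H]]]] d0 Sh.
have e1 : 0 < enorm h + 1 by rewrite ltr_wpDl // enorm_ge0.
apply: (@le_linear_error (Num.min d (d1 / (enorm h + 1))) _ _ (sg * enorm h ^+ 2)).
  by rewrite lt_min d0 divr_gt0.
move=> t t0; rewrite lt_min => /andP[td]; rewrite ltr_pdivlMr // => tl.
have := H _ _ (Sh t t0 td); rewrite addrC addKr enormZ gtr0_norm // dotZr.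
rewrite mulrDr mulr1 in tl; rewrite [a + _]addrC addrK.
have -> : t * c + sg * (t * enorm h) ^+ 2 = t * (c + t * (sg * enorm h ^+ 2)) by ring.
by rewrite ler_pM2l //; apply; lra.
Qed.

(** The direction [v] itself gives [|v|^2 <= L |v|]. *)
Lemma prox_subgrad_lip k (S : 'rV[R]_k -> R -> Prop) w a v L d :
  prox_subgrad S w a v -> 0 < d -> 0 <= L ->
  (forall h, enorm h < d -> S (w + h) (a + L * enorm h)) -> enorm v <= L.
Proof.
move=> Sv d0 L0 H; have := enorm_ge0 v; rewrite le_eqVlt => /predU1P[<-//|v0].
rewrite -(ler_pM2r v0) -expr2 enorm_sqr.
apply: (prox_subgrad_dir Sv (divr_gt0 d0 v0)) => t t0; rewrite ltr_pdivlMr // => tv.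
have := H (t *: v); rewrite enormZ gtr0_norm // => /(_ tv).
by rewrite mulrCA.
Qed.

(** The point [s] is nearest to [s + t v] exactly when [2 t <v, s' - s> <= |s' - s|^2] on [S].
    Within radius [d] the quadratic inequality gives this for small [t]; beyond it, Cauchy-Schwarz
    does. *)
Lemma prox_normal_proj k (S : set 'rV[R]_k) s v e : prox_normal S s v -> 0 < e ->
  exists t, [/\ 0 < t, t * enorm v < e & proj (s + t *: v) S s].
Proof.
move=> [Ss [sg [d [d0 H]]]] e0.
(* With [t = 1 / D], the first summand serves points within [d], the second those beyond; the third
   and the 1 give [t |v| < e] and positivity. *)
set D := 2 * `|sg| + 2 * enorm v / d + enorm v / e + 1.
have p1 : 0 <= enorm v / d by rewrite divr_ge0 ?enorm_ge0 ?ltW.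
have p2 : 0 <= enorm v / e by rewrite divr_ge0 ?enorm_ge0 ?ltW.
have p3 : 0 <= `|sg| by [].
have D0 : 0 < D by rewrite /D -mulrA; lra.
have t0 : 0 < D^-1 by rewrite invr_gt0.
exists D^-1; split=> //.
  rewrite mulrC ltr_pdivrMr // mulrC -ltr_pdivrMr // /D -mulrA; lra.
split=> // s' Ss'; rewrite addrC addKr.
have -> : s + D^-1 *: v - s' = D^-1 *: v - (s' - s) by rewrite opprB addrCA addrA.
rewrite -(@ler_pXn2r _ 2) ?nnegrE ?enorm_ge0 // enorm_sqrB dotZl.
set x := dot v _; set y := enorm (s' - s).
rewrite -addrA lerDl addrC subr_ge0.
have y0 : 0 <= y by exact: enorm_ge0.
suff : 2 * x <= D * y ^+ 2.
  by move=> h; rewrite mulrCA mulrC ler_pdivrMr // [_ * D]mulrC.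
have [yd|yd] := leP y d.
  apply: (@le_trans _ _ (2 * `|sg| * y ^+ 2)).
    rewrite -mulrA ler_pM2l //; apply: le_trans (H _ Ss' yd) _.
    by rewrite ler_wpM2r ?sqr_ge0 // ler_norm.
  by rewrite ler_wpM2r ?sqr_ge0 // /D -mulrA; lra.
apply: (@le_trans _ _ (2 * enorm v / d * y ^+ 2)); last first.
  by rewrite ler_wpM2r ?sqr_ge0 // /D -mulrA; lra.
rewrite -!mulrA ler_pM2l //; apply: le_trans (dot_le _ _) _.
rewrite ler_wpM2l ?enorm_ge0 // mulrC ler_pdivlMr // expr2 -/y.
by rewrite ler_wpM2l // ltW.
Qed.

Lemma prox_subgrad_epi k (psi : 'rV[R]_k -> \bar R) w a v :
  prox_subgrad (fun w a => (psi w <= a%:E)%E) w a v ->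
  prox_normal (epi psi) (pr w (r1 a)) (pr v (r1 (-1))).
Proof.
move=> [S0 [sg [d [d0 H]]]]; split; first by exists w, a.
(* The norm of the pair dominates that of [w' - w]; a negative [sg] would turn this the wrong way,
   hence the absolute value. *)
exists `|sg|, d; split=> // _ [w' [a' [le ->]]]; rewrite prB r1B dot_pr dot_r1 => dle.
have := H _ _ le (le_trans (enorm_prl _ _) dle) => {}H.
rewrite mulN1r lerBlDl; apply: (le_trans H); rewrite lerD2l.
apply: (@le_trans _ _ (`|sg| * enorm (w' - w) ^+ 2)).
  by rewrite ler_wpM2r ?sqr_ge0 // ler_norm.
by rewrite ler_wpM2l // enorm_pr lerDl sqr_ge0.
Qed.

(** Translate [w] together with its projection: [w + (s' - y)] is at distance at most [|w - y|] from
    [s'], so the height [a] is still admissible there and only the quadratic term remains. *)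
Lemma prox_subgrad_dist k (S : set 'rV[R]_k) w a v y :
  prox_subgrad (fun w a => dist w S <= a) w a v -> proj w S y -> prox_normal S y v.
Proof.
move=> [Sa [sg [d [d0 H]]]] py; have Sy := py.1; split=> //; exists sg, d; split=> // s' Ss' le.
have := H (w + (s' - y)) a _; rewrite [w + _]addrC addrK subrr add0r; apply => //.
apply: le_trans Sa; rewrite (dist_proj py).
apply: le_trans (dist_le _ Ss') _.
suff -> : s' - y + w - s' = w - y by [].
by rewrite addrC -addrA addrCA !addrA subrr add0r addrC.
Qed.

Lemma prox_subgrad_dist_norm k (S : set 'rV[R]_k) w a v : S !=set0 ->
  prox_subgrad (fun w a => dist w S <= a) w a v -> enorm v <= 1.
Proof.
move=> S0 H; have Ha := H.1; apply: (prox_subgrad_lip H ltr01 ler01) => h _.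
apply: le_trans (dist_lip _ w S0) _.
by rewrite [w + h]addrC addrK mul1r lerD2r.
Qed.

(** When [S] is the epigraph of a function, [S w (a / c)] is that of its multiple by [c]. *)
Lemma prox_subgrad_scale k (S : 'rV[R]_k -> R -> Prop) c w a v : 0 < c ->
  prox_subgrad (fun w a => S w (a / c)) w a v -> prox_subgrad S w (a / c) (c^-1 *: v).
Proof.
move=> c0 [Sa [sg [d [d0 H]]]]; split=> //; exists (sg / c), d; split=> // w' a' le dle.
have := H w' (a' * c) _ dle; rewrite mulfK ?gt_eqF // => /(_ le) {}H.
rewrite dotZl mulrC ler_pdivrMr //; apply: (le_trans H).
by rewrite le_eqVlt; apply/orP; left; apply/eqP; field; rewrite gt_eqF.
Qed.

End Proximal.

(** * Limits of proximal normals and subgradients *)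

Section Limits.
Variables (R : realType) (U : set_system nat).
Hypotheses (UU : UltraFilter U) (Uoo : \oo `<=` U).
Implicit Types (k : nat).

(** Passing from [U] to ordinary sequences: for each [j] some index [i] has errors below
    [1 / (j + 1)], and the base point is moved to [s i + t *: v i], which projects onto [s i], at a
    cost below [1 / (j + 1)]. *)
Lemma ncone_lim k (S : set 'rV[R]_k) sb q (s v : nat -> 'rV[R]_k) : S sb ->
  vcv U s sb -> vcv U v q -> (\forall j \near U, prox_normal S (s j) (v j)) -> ncone sb S q.
Proof.
move=> Ssb /(vcvP UU) hs /(vcvP UU) hv hp; split=> //.
have /choice [z hz] : forall j : nat, exists z : 'rV[R]_k * 'rV[R]_k,
    [/\ enorm (z.1 - sb) < j.+1%:R^-1 + j.+1%:R^-1, enorm (z.2 - q) < j.+1%:R^-1 &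
     coneof [set z.1 - y | y in proj z.1 S] z.2].
  move=> j; have e0 := @invSn_gt0 R j.
  have [i [[h1 h2] h3]] := filter_ex (filterI (filterI (hs _ e0) (hv _ e0)) hp).
  have [t [t0 tv pj]] := prox_normal_proj h3 e0.
  exists (s i + t *: v i, v i); split=> //=.
    rewrite addrAC; apply: le_lt_trans (enormD _ _) _.
    by rewrite ltrD // enormZ gtr0_norm.
  exists t^-1, (t *: v i); split; first by rewrite invr_ge0 ltW.
  split; first by exists (s i) => //; rewrite addrAC subrr add0r.
  by rewrite scalerA mulVf ?gt_eqF // scale1r.
have small e : 0 < e -> exists N, forall j, (N <= j)%N -> j.+1%:R^-1 < e :> R.
  move=> e0; have e1 : 0 <= e^-1 by rewrite invr_ge0 ltW.
  have /andP[_ h] := truncn_itv e1.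
  exists (Num.truncn e^-1) => j hj; rewrite invf_plt ?posrE //.
  by apply: lt_le_trans h _; rewrite ler_nat.
exists (fun j => (z j).1), (fun j => (z j).2); split; last split.
- move=> e e0; have [N hN] := small (e / 2) (divr_gt0 e0 (ltr0Sn R 1)).
  exists N => j /hN hj; have [h1 _ _] := hz j.
  by apply: (lt_trans h1); rewrite [e]splitr ltrD.
- move=> e e0; have [N hN] := small e e0.
  by exists N => j /hN hj; have [_ h1 _] := hz j; apply: (lt_trans h1).
- by move=> j; have [_ _ ?] := hz j.
Qed.

Lemma vcv_pr k l (u : nat -> 'rV[R]_k) (v : nat -> 'rV[R]_l) a b :
  vcv U u a -> vcv U v b -> vcv U (fun j => pr (u j) (v j)) (pr a b).
Proof.
move=> hu hv.
apply: (@vcv_le _ _ UU _ _ _ (fun j => enorm (u j - a) + enorm (v j - b))).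
  by near=> j; rewrite prB enorm_pr_le.
by rewrite -[X in _ --> X]addr0; apply: cvgD.
Unshelve. all: by end_near. Qed.

Lemma vcv_r1 (u : nat -> R) (a : R) : u j @[j --> U] --> a -> vcv U (fun j => r1 (u j)) (r1 a).
Proof.
move=> h; rewrite /vcv; under eq_fun do rewrite r1B enorm_r1.
by rewrite -(normr0 R) -(subrr a); apply: cvg_norm; apply: cvgB => //; apply: cvg_cst.
Qed.

(** Convergence of the heights is a separate hypothesis because [psi] may be discontinuous, while
    the normals must be taken at points of the epigraph tending to [(wb, psi wb)]. *)
Lemma subdiff_lim k (psi : 'rV[R]_k -> \bar R) wb q (w v : nat -> 'rV[R]_k) (a : nat -> R) :
  psi wb \is a fin_num -> vcv U w wb -> a j @[j --> U] --> fine (psi wb) -> vcv U v q ->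
  (\forall j \near U, prox_subgrad (fun w a => (psi w <= a%:E)%E) (w j) (a j) (v j)) ->
  subdiff psi wb q.
Proof.
move=> fn hw ha hv hp; split=> //.
apply: (ncone_lim _ (vcv_pr hw (vcv_r1 ha)) (vcv_pr hv (vcv_cst _ (r1 (-1))))) => //.
  by exists wb, (fine (psi wb)); rewrite fineK.
by apply: filterS hp => j /prox_subgrad_epi.
Qed.

(** The scaled epigraph normals [t (v, -1)] have last component [- t], which tends to 0. *)
Lemma subdiff_inf_lim k (psi : 'rV[R]_k -> \bar R) wb q (w v : nat -> 'rV[R]_k) (a t : nat -> R) :
  psi wb \is a fin_num -> vcv U w wb -> a j @[j --> U] --> fine (psi wb) ->
  (\forall j \near U, 0 <= t j) -> t j @[j --> U] --> (0 : R) ->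
  vcv U (fun j => t j *: v j) q ->
  (\forall j \near U, prox_subgrad (fun w a => (psi w <= a%:E)%E) (w j) (a j) (v j)) ->
  subdiff_inf psi wb q.
Proof.
move=> fn hw ha t0 ht hv hp; split=> //.
apply: (ncone_lim _ (vcv_pr hw (vcv_r1 ha)) (v := fun j => t j *: pr (v j) (r1 (-1)))) => //.
- by exists wb, (fine (psi wb)); rewrite fineK.
- have -> : r1 (0 : R) = 0 *: r1 (-1) by rewrite r1Z mul0r.
  apply: (vcv_ext _ (vcv_pr hv (vcvZ UU ht (vcv_cst _ (r1 (-1)))))) => j.
  by rewrite prZ.
- by apply: filterS (filterI t0 hp) => j [tj /prox_subgrad_epi]; apply: prox_normal_scale.
Qed.

End Limits.

(** * Fuzzy sum rule *)

Section FuzzySum.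
Variables (R : realType) (U : set_system nat).
Hypotheses (UU : UltraFilter U) (Uoo : \oo `<=` U).

(** For an epigraph this is lower semicontinuity. *)
Definition closed_rel k (S : 'rV[R]_k -> R -> Prop) : Prop := forall w a,
  (forall e, 0 < e -> exists w' a', [/\ enorm (w' - w) < e, `|a' - a| < e & S w' a']) -> S w a.

Lemma vcv_rclosed k (S : 'rV[R]_k -> R -> Prop) w a (wj : nat -> 'rV[R]_k) (aj : nat -> R) :
  closed_rel S -> vcv U wj w -> aj j @[j --> U] --> a -> (\forall j \near U, S (wj j) (aj j)) ->
  S w a.
Proof.
move=> Sc /(vcvP UU) hw /cvgrPdist_lt ha hS; apply: Sc => e e0.
have [j [[h1 h2] h3]] := filter_ex (filterI (filterI (hw _ e0) (ha _ e0)) hS).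
by exists (wj j), (aj j); rewrite distrC.
Qed.

Variables (k : nat) (I : finType) (S : I -> 'rV[R]_k -> R -> Prop).
Variables (wb : 'rV[R]_k) (ab B : I -> R) (r : R).
Hypotheses (r0 : 0 < r) (Sclosed : forall i, closed_rel (S i)).
Hypothesis SB : forall i w a, S i w a -> enorm (w - wb) <= r -> B i <= a.
Hypothesis Sab : forall i, S i wb (ab i).
Hypothesis ab_min : forall i a, S i wb a -> ab i <= a.
Hypothesis loc_min : forall w a, enorm (w - wb) <= r -> (forall i, S i w (a i)) ->
  \sum_i ab i <= \sum_i a i.

(* Points are triples of a centre w0, the decoupled variables w_i and the
   heights a_i; [F t] penalizes the deviations w_i - w0 with weight t. *)
Let T := ('rV[R]_k * ((I -> 'rV[R]_k) * (I -> R)))%type.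
Let D : set T := [set P | forall i, enorm (P.2.1 i - wb) <= r /\ S i (P.2.1 i) (P.2.2 i)].
Let F t (P : T) := \sum_i P.2.2 i + t * (\sum_i enorm (P.2.1 i - P.1) ^+ 2) +
  enorm (P.1 - wb) ^+ 2.
Let base : T := (wb, (fun=> wb, ab)).

Let D_base : D base.
Proof. by move=> i /=; rewrite subrr enorm0 ltW. Qed.

Let F_base t : F t base = \sum_i ab i.
Proof.
rewrite /F /= subrr enorm0 expr0n /= addr0 [X in _ * X]big1 ?mulr0 ?addr0 //.
Qed.

Let sumsq_ge0 (P : T) : 0 <= \sum_i enorm (P.2.1 i - P.1) ^+ 2.
Proof. by apply: sumr_ge0 => i _; apply: sqr_ge0. Qed.

(** Each height is at least [B i] and the other terms are nonnegative, so the excess of [M] over the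
    sum of the [B i] bounds every term on its own; the last bound rests on [x <= x ^+ 2 + 1]. *)
Let D_bound P t M : D P -> 0 <= t -> F t P <= M ->
  [/\ forall i, `|P.2.2 i - B i| <= M - \sum_i B i,
      t * (\sum_i enorm (P.2.1 i - P.1) ^+ 2) <= M - \sum_i B i &
      enorm (P.1 - wb) <= M - \sum_i B i + 1].
Proof.
move=> DP t0 FM; have aB i : B i <= P.2.2 i by have [h1 h2] := DP i; apply: SB h2 h1.
have s0 := mulr_ge0 t0 (sumsq_ge0 P); have n0 := sqr_ge0 (enorm (P.1 - wb)).
have sB : \sum_i B i <= \sum_i P.2.2 i by apply: ler_sum.
rewrite /F in FM; set x := enorm (P.1 - wb) in n0 FM *.
split=> [i||].
- rewrite ger0_norm ?subr_ge0 //.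
  apply: (@le_trans _ _ (\sum_i (P.2.2 i - B i))); last by rewrite sumrB; lra.
  by rewrite (bigD1 i) //= lerDl; apply: sumr_ge0 => i' _; rewrite subr_ge0.
- lra.
- have xM : x ^+ 2 <= M - \sum_i B i by lra.
  by rewrite leNgt; apply/negP => lt; nra.
Qed.

Let near_bounded_limits (P : nat -> T) (t : nat -> R) M : (forall j, D (P j)) ->
  (forall j, 0 <= t j) -> (forall j, F (t j) (P j) <= M) ->
  exists Q : T, [/\ vcv U (fun j => (P j).1) Q.1,
    forall i, vcv U (fun j => (P j).2.1 i) (Q.2.1 i),
    forall i, (P j).2.2 i @[j --> U] --> Q.2.2 i & D Q].
Proof.
move=> DP t0 FM.
have [w0 hw0] : exists l, vcv U (fun j => (P j).1) l.
  apply: (@vcv_bounded _ _ UU _ _ (M - \sum_i B i + 1 + enorm wb)); near=> j.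
  have [_ _ h] := D_bound (DP j) (t0 j) (FM j).
  have := enorm_tri wb (P j).1 0; rewrite !subr0; lra.
have /choice [w hw] : forall i, exists l, vcv U (fun j => (P j).2.1 i) l.
  move=> i; apply: (@vcv_bounded _ _ UU _ _ (r + enorm wb)); near=> j.
  have [h _] := DP j i.
  have := enorm_tri wb ((P j).2.1 i) 0; rewrite !subr0; lra.
have /choice [a ha] : forall i, exists l : R, (P j).2.2 i @[j --> U] --> l.
  move=> i; apply: (@ultra_cvg_bounded _ _ UU _ (M - \sum_i B i + `|B i|)); near=> j.
  have [h _ _] := D_bound (DP j) (t0 j) (FM j).
  by have := ler_normD ((P j).2.2 i - B i) (B i); rewrite subrK; have := h i; lra.
exists (w0, (w, a)); split=> //= i; split.
  apply: (vcv_norm_le UU (vcvB UU (hw i) (vcv_cst _ wb))).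
  by near=> j; have [] := DP j i.
apply: (vcv_rclosed (@Sclosed i) (hw i) (ha i)).
by near=> j; have [] := DP j i.
Unshelve. all: by end_near. Qed.

Let F_cvg t (P : nat -> T) (Q : T) : vcv U (fun j => (P j).1) Q.1 ->
  (forall i, vcv U (fun j => (P j).2.1 i) (Q.2.1 i)) ->
  (forall i, (P j).2.2 i @[j --> U] --> Q.2.2 i) -> F t (P j) @[j --> U] --> F t Q.
Proof.
move=> h0 hw ha.
have sq l (u : nat -> 'rV[R]_l) v : vcv U u v -> enorm (u j) ^+ 2 @[j --> U] --> enorm v ^+ 2.
  by move=> /(vcv_norm UU) h; rewrite expr2; under eq_fun do rewrite expr2; apply: cvgM.
apply: cvgD; first apply: cvgD.
- exact: (@cvgr_sum _ _ UU _ (fun i j => (P j).2.2 i)).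
- apply: cvgM; first exact: cvg_cst.
  apply: (@cvgr_sum _ _ UU _ (fun i j => enorm ((P j).2.1 i - (P j).1) ^+ 2)
    (fun i => enorm (Q.2.1 i - Q.1) ^+ 2)) => i.
  by apply: sq; apply: vcvB.
- by apply: sq; apply: (vcvB UU) => //; apply: vcv_cst.
Qed.

Let minimizer t : 0 <= t -> exists2 P, D P & forall Q, D Q -> F t P <= F t Q.
Proof.
move=> t0; apply: (@exists_min _ _ UU Uoo _ D (F t) (\sum_i B i) base D_base).
  move=> P DP; have [] := D_bound DP t0 (lexx _) => _ _.
  have aB i : B i <= P.2.2 i by have [h1 h2] := DP i; apply: SB h2 h1.
  move=> _; have s0 := mulr_ge0 t0 (sumsq_ge0 P); have n0 := sqr_ge0 (enorm (P.1 - wb)).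
  have sB : \sum_i B i <= \sum_i P.2.2 i by apply: ler_sum.
  by rewrite /F; lra.
move=> P c M DP FM Fc.
have [Q [h0 hw ha DQ]] := near_bounded_limits DP (fun=> t0) FM.
exists Q => //; rewrite (cvg_unique _ Fc (F_cvg (t := t) h0 hw ha)) //.
Qed.

(* The penalty forces the limits of all w_i to agree; local minimality of wb and
   the term |w0 - wb|^2 then identify them with wb. *)
Let penalized_min_cvg (P : nat -> T) : (forall j, D (P j)) ->
  (forall j Q, D Q -> F j.+1%:R (P j) <= F j.+1%:R Q) ->
  [/\ vcv U (fun j => (P j).1) wb, forall i, vcv U (fun j => (P j).2.1 i) wb &
    forall i, (P j).2.2 i @[j --> U] --> ab i].
Proof.
move=> DP Pmin.
have FM j : F j.+1%:R (P j) <= \sum_i ab i by rewrite -(F_base j.+1%:R); apply: Pmin.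
have t0 j : 0 <= j.+1%:R :> R by [].
have [[w0 [w a]] /= [h0 hw ha DQ]] := near_bounded_limits DP t0 FM.
set M := \sum_i ab i - \sum_i B i.
have ww0 i : w i = w0.
  apply/eqP; rewrite -subr_eq0; apply/eqP; apply: enorm_sqr_le0.
  have h := vcv_norm UU (vcvB UU (hw i) h0).
  have M0 : M * j.+1%:R^-1 @[j --> U] --> M * (0 : R).
    by apply: cvgM; [exact: cvg_cst | exact: cvg_invSn].
  rewrite mulr0 in M0; apply: (ler_cvg_to (cvgM h h) M0); near=> j.
  have [_ h1 _] := D_bound (DP j) (t0 j) (FM j).
  rewrite ler_pdivlMr ?ltr0n // mulrC; apply: le_trans h1.
  rewrite ler_wpM2l // (bigD1 i) //= expr2 lerDl.
  by apply: sumr_ge0 => i' _; apply: sqr_ge0.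
(* The weights [j.+1] diverge, so the limit is taken after the nonnegative penalty has been
   dropped. *)
have lim0 : F 0 (w0, (w, a)) <= \sum_i ab i.
  apply: (cvgr_to_le (F_cvg (t := 0) (Q := (w0, (w, a))) h0 hw ha)); near=> j.
  apply: le_trans (FM j); rewrite /F lerD2r lerD2l mul0r.
  by rewrite mulr_ge0.
have Sa i : S i w0 (a i) by rewrite -(ww0 i); have [] := DQ i.
have w0r (i : I) : enorm (w0 - wb) <= r by rewrite -(ww0 i); have [] := DQ i.
rewrite /F /= mul0r addr0 in lim0.
have w0b : w0 = wb.
  (* That [w0] lies in the ball is known only through some [w i]; for an empty [I] both sums vanish
     and the square alone gives the claim. *)
  case: (pickP (predT : pred I)) => [i _|noI].
    have := loc_min (w0r i) Sa => h.
    apply/eqP; rewrite -subr_eq0; apply/eqP; apply: enorm_sqr_le0.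
    by rewrite -(lerD2l (\sum_i a i)) addr0; apply: le_trans lim0 h.
  rewrite !big_pred0 // add0r in lim0.
  by apply/eqP; rewrite -subr_eq0; apply/eqP; apply: enorm_sqr_le0.
rewrite w0b in Sa h0 ww0 lim0 *.
have aab i : ab i <= a i by apply: ab_min.
have eqa i : a i = ab i.
  apply/eqP; rewrite eq_le aab andbT.
  have : \sum_i (a i - ab i) <= 0.
    by rewrite sumrB subr_le0; rewrite subrr enorm0 expr0n /= addr0 in lim0.
  rewrite (bigD1 i) //=; have : 0 <= \sum_(i' | i' != i) (a i' - ab i').
    by apply: sumr_ge0 => i' _; rewrite subr_ge0.
  by move=> h h1; rewrite -subr_le0; apply: le_trans h1; rewrite lerDl.
split=> // i; first by rewrite -(ww0 i).
by rewrite -eqa.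
Unshelve. all: by end_near. Qed.

Let upd (X : Type) (f : I -> X) i x : I -> X := fun i' => if i' == i then x else f i'.

Let upd_sum (X : Type) (f : I -> X) i x (g : X -> R) :
  \sum_i' g (upd f i x i') = g x + \sum_(i' | i' != i) g (f i').
Proof.
rewrite (bigD1 i) //= /upd eqxx; congr (_ + _).
by apply: eq_bigr => i' /negbTE ->.
Qed.

(** Vary only the i-th point and height. Expanding the penalty around [w i] gives the linear term
    [- 2 t <w0 - w i, w' - w i>] and the remainder [t |w' - w i|^2], so [t] serves as the quadratic
    constant; the margin [d] keeps [w'] in the ball. *)
Let min_prox_subgrad t (P : T) i d : 0 < d -> D P -> (forall Q, D Q -> F t P <= F t Q) ->
  enorm (P.2.1 i - wb) + d <= r ->
  prox_subgrad (S i) (P.2.1 i) (P.2.2 i) ((2 * t) *: (P.1 - P.2.1 i)).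
Proof.
case: P => w0 [w a] /= d0 DP Pmin wd; have [_ Si] := DP i; split=> //.
exists t, d; split=> // w' a' S' le.
have := Pmin (w0, (upd w i w', upd a i a')).
have /[swap]/[apply] : D (w0, (upd w i w', upd a i a')).
  move=> i' /=; rewrite /upd; case: eqVneq => [->|_]; last exact: DP.
  split=> //; have := enorm_tri (w i) w' wb; lra.
rewrite /F /= (upd_sum a i a' id) (upd_sum w i w' (fun x => enorm (x - w0) ^+ 2)).
rewrite !(bigD1 i (P := predT)) //=.
have -> : enorm (w' - w0) ^+ 2 =
    enorm (w' - w i) ^+ 2 - 2 * dot (w0 - w i) (w' - w i) + enorm (w i - w0) ^+ 2.
  rewrite (enormBC (w i)) (dotC (w0 - _)) -enorm_sqrB.
  by congr (enorm _ ^+ 2); rewrite opprB addrA subrK.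
rewrite dotZl; set x := enorm (w' - w i) ^+ 2; set y := dot _ _; lra.
Qed.

(** Stationarity in the centre [w0], which [D] leaves free: [g] is the gradient of [F t] in [w0],
    and the step [- s *: g] would lower the value if [g] were nonzero. *)
Let min_sum t (P : T) : D P -> (forall Q, D Q -> F t P <= F t Q) ->
  \sum_i (2 * t) *: (P.1 - P.2.1 i) = - (2 *: (P.1 - wb)).
Proof.
case: P => w0 [w a] /= DP Pmin; apply/eqP; rewrite -addr_eq0; apply/eqP.
set g := _ + _; apply: enorm_sqr_le0.
apply: (@le_linear_error _ 1 _ _ ((t * #|I|%:R + 1) * enorm g ^+ 2)) => // s s0 _.
have := Pmin (w0 - s *: g, (w, a)) DP; rewrite /F /=.
have e1 : enorm (w0 - s *: g - wb) ^+ 2 =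
    enorm (w0 - wb) ^+ 2 - 2 * s * dot (w0 - wb) g + s ^+ 2 * enorm g ^+ 2.
  have -> : w0 - s *: g - wb = (w0 - wb) - s *: g by rewrite addrAC.
  by rewrite (enorm_sqrB (w0 - wb)) dotZr enormZ gtr0_norm // exprMn mulrA.
have e2 : \sum_i enorm (w i - (w0 - s *: g)) ^+ 2 =
    \sum_i enorm (w i - w0) ^+ 2 - 2 * s * dot (\sum_i (w0 - w i)) g
      + #|I|%:R * (s ^+ 2 * enorm g ^+ 2).
  have -> c : #|I|%:R * c = \sum_(i : I) c :> R by rewrite sumr_const mulr_natl.
  rewrite dotC dot_sumr mulr_sumr -sumrB -big_split /=.
  apply: eq_bigr => i _.
  have -> : w i - (w0 - s *: g) = (w i - w0) - (- s) *: g.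
    by rewrite scaleNr opprK opprB addrCA addrC.
  rewrite (enorm_sqrB (w i - w0)) dotZr enormZ normrN gtr0_norm // exprMn.
  by rewrite -(opprB (w i)) dotNr (dotC g); ring.
have eg : enorm g ^+ 2 = 2 * t * dot (\sum_i (w0 - w i)) g + 2 * dot (w0 - wb) g.
  by rewrite {1}enorm_sqr {1}/g (dotDl _ (2 *: _)) -scaler_sumr !dotZl.
rewrite e1 e2.
set x := dot (\sum_i _) g in eg *; set y := dot _ g in eg *; set z := enorm g ^+ 2 in eg *.
set N := #|I|%:R; set A := \sum_i enorm _ ^+ 2; set b := enorm _ ^+ 2.
move=> h; have {}h : s * z <= s * (s * ((t * N + 1) * z)).
  rewrite eg in h *; lra.
by rewrite ler_pM2l // in h; rewrite add0r.
Qed.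

(** The individual subgradients [2 t (w0 - w_i)] may be large, but by [min_sum] they add up to
    [- 2 (w0 - wb)], which tends to 0. *)
Theorem fuzzy_sum e : 0 < e -> exists w a v,
  (forall i, [/\ enorm (w i - wb) < e, `|a i - ab i| < e &
     prox_subgrad (S i) (w i) (a i) (v i)]) /\
  enorm (\sum_i v i) < e.
Proof.
move=> e0.
have /choice [P hP] : forall j : nat, exists P, D P /\
    forall Q, D Q -> F j.+1%:R P <= F j.+1%:R Q.
  by move=> j; have [P] := @minimizer j.+1%:R (ler0n _ _); exists P.
have [h0 hw ha] := penalized_min_cvg (fun j => (hP j).1) (fun j => (hP j).2).
have e2 : 0 < e / 2 by rewrite divr_gt0.
have er : 0 < Num.min e (r / 2) by rewrite lt_min e0 divr_gt0.
have nw : \forall j \near U, forall i, enorm ((P j).2.1 i - wb) < Num.min e (r / 2).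
  by apply: filter_forall => i; apply: (vcvP UU _ _).1.
have na : \forall j \near U, forall i, `|(P j).2.2 i - ab i| < e.
  apply: filter_forall => i; have /cvgrPdist_lt := ha i => /(_ _ e0).
  by apply: filterS => j; rewrite distrC.
have [j [[hj1 hj2] hj3]] := filter_ex (filterI (filterI nw na) ((vcvP UU _ _).1 h0 _ e2)).
have [DP Pmin] := hP j.
exists (P j).2.1, (P j).2.2, (fun i => (2 * j.+1%:R) *: ((P j).1 - (P j).2.1 i)).
split=> [i|]; last first.
  by rewrite (min_sum DP Pmin) enormN enormZ ger0_norm // mulrC -ltr_pdivlMr.
have := hj1 i; rewrite lt_min => /andP[h1 h2]; split=> //.
by apply: (@min_prox_subgrad _ _ _ (r / 2)) => //; [rewrite divr_gt0 | lra].
Qed.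

End FuzzySum.

(** * Distance functions and the error bound *)

Section ErrorBound.
Variables (R : realType) (U : set_system nat).
Hypotheses (UU : UltraFilter U) (Uoo : \oo `<=` U).

Corollary fuzzy_sum_cvg k (I : finType) (S : I -> 'rV[R]_k -> R -> Prop)
    (wb : 'rV[R]_k) (ab B : I -> R) (r : R) :
  0 < r -> (forall i, closed_rel (S i)) ->
  (forall i w a, S i w a -> enorm (w - wb) <= r -> B i <= a) ->
  (forall i, S i wb (ab i)) -> (forall i a, S i wb a -> ab i <= a) ->
  (forall w a, enorm (w - wb) <= r -> (forall i, S i w (a i)) ->
     \sum_i ab i <= \sum_i a i) ->
  exists (w v : I -> nat -> 'rV[R]_k) (a : I -> nat -> R),
    (forall i, [/\ vcv U (w i) wb, a i j @[j --> U] --> ab i &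
                   forall j, prox_subgrad (S i) (w i j) (a i j) (v i j)]) /\
    vcv U (fun j => \sum_i v i j) 0.
Proof.
move=> r0 Sc SB Sab abm lm.
have /choice [P hP] : forall j : nat, exists P : (I -> 'rV[R]_k) * (I -> R) * (I -> 'rV[R]_k),
  (forall i, [/\ enorm (P.1.1 i - wb) < j.+1%:R^-1, `|P.1.2 i - ab i| < j.+1%:R^-1 &
    prox_subgrad (S i) (P.1.1 i) (P.1.2 i) (P.2 i)]) /\ enorm (\sum_i P.2 i) < j.+1%:R^-1.
  move=> j; have [w [a [v h]]] := fuzzy_sum UU Uoo r0 Sc SB Sab abm lm (@invSn_gt0 R j).
  by exists (w, a, v).
exists (fun i j => (P j).1.1 i), (fun i j => (P j).2 i), (fun i j => (P j).1.2 i); split.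
  move=> i; split=> [||j]; last by have [/(_ i) []] := hP j.
  - apply: (@vcv_le _ _ UU _ _ _ (fun j => j.+1%:R^-1)); last exact: cvg_invSn.
    by near=> j; have [/(_ i) [/ltW]] := hP j.
  - have /cvgrPdist_lt inv0 := @cvg_invSn R U UU Uoo; apply/cvgrPdist_lt => e /inv0.
    apply: filterS => j; rewrite sub0r normrN ger0_norm // distrC.
    by apply: lt_trans; have [/(_ i) []] := hP j.
apply: (@vcv_le _ _ UU _ _ _ (fun j => j.+1%:R^-1)); last exact: cvg_invSn.
by near=> j; rewrite subr0; have [_ /ltW] := hP j.
Unshelve. all: by end_near. Qed.

Lemma cvg_dist k (S : set 'rV[R]_k) (w : nat -> 'rV[R]_k) wb : S !=set0 ->
  vcv U w wb -> dist (w j) S @[j --> U] --> dist wb S.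
Proof.
move=> S0 /(vcvP UU) hw; apply/cvgrPdist_lt => e /hw; apply: filterS => j.
apply: le_lt_trans; rewrite ler_norml.
have h1 := dist_lip wb (w j) S0; have h2 := dist_lip (w j) wb S0.
by rewrite (enormBC wb) in h1; apply/andP; split; lra.
Qed.

(* Moving from w towards y decreases the distance at unit rate, so v has inner
   product at least 1 with the unit vector (w - y) / dist w S; as |v| <= 1, they
   coincide. *)
Lemma prox_subgrad_dist_out k (S : set 'rV[R]_k) w a v y : S !=set0 -> 0 < dist w S ->
  prox_subgrad (fun w a => dist w S <= a) w a v -> proj w S y -> dist w S *: v = w - y.
Proof.
move=> S0 d0 H py; have v1 := prox_subgrad_dist_norm S0 H; set d := dist w S in d0 *.
have dE : enorm (w - y) = d by rewrite -(dist_proj py).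
suff : v - d^-1 *: (w - y) = 0.
  by move=> /eqP; rewrite subr_eq0 => /eqP ->; rewrite scalerA mulfV ?gt_eqF // scale1r.
apply: enorm_sqr_le0; rewrite enorm_sqrB enormZ gtr0_norm ?invr_gt0 // dE mulVf ?gt_eqF //.
have : dot v (- (d^-1 *: (w - y))) <= -1.
  apply: (prox_subgrad_dir H d0) => t t0 td; have := H.1 => /= Ha.
  rewrite mulrN1; apply: (@le_trans _ _ (d - t)); last by rewrite lerD2r.
  apply: le_trans (dist_le _ py.1) _.
  have -> : w + t *: - (d^-1 *: (w - y)) - y = (1 - t / d) *: (w - y).
    by rewrite scalerN addrAC scalerBl scale1r scalerA.
  rewrite enormZ dE ger0_norm; last first.
    by rewrite subr_ge0 ler_pdivrMr // mul1r ltW.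
  by rewrite mulrBl mul1r mulfVK ?gt_eqF.
rewrite dotNr => h; have v0 := enorm_ge0 v.
have : enorm v ^+ 2 <= 1 by rewrite expr_le1.
rewrite expr1n; lra.
Qed.

Section DistLimits.
Variables (k : nat) (S : set 'rV[R]_k) (wb q : 'rV[R]_k).
Variables (w v : nat -> 'rV[R]_k) (a : nat -> R).
Hypotheses (Sc : eclosed S) (S0 : S !=set0).
Hypotheses (hw : vcv U w wb) (hv : vcv U v q).
Hypothesis hp : forall j, prox_subgrad (fun w a => dist w S <= a) (w j) (a j) (v j).

Lemma prox_subgrad_dist_lim_norm : enorm q <= 1.
Proof.
apply: (vcv_norm_le UU hv); near=> j; exact: prox_subgrad_dist_norm (hp j).
Unshelve. all: by end_near. Qed.

(** The projections [y j] tend to [wb] with [w j], because [wb] is itself a competitor in [S]. *)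
Lemma prox_subgrad_dist_lim_in : S wb -> ncone wb S q.
Proof.
move=> Swb; have /choice [y hy] := fun j => exists_proj UU Uoo (w j) Sc S0.
apply: (ncone_lim UU Swb _ hv (s := y)).
- apply: (@vcv_le _ _ UU _ _ _ (fun j => enorm (w j - wb) + enorm (w j - wb))).
    near=> j; apply: le_trans (enorm_tri (w j) _ _) _.
    by rewrite lerD2r enormBC; apply: (hy j).2.
  by rewrite -[X in _ --> X]addr0; apply: cvgD.
- by near=> j; apply: prox_subgrad_dist (hp j) (hy j).
Unshelve. all: by end_near. Qed.

(** Off [S] the projection of [w j] equals [w j - dist (w j) S *: v j]. These points converge, their
    limit is in the closed set [S], and [enorm q <= 1] makes it nearest to [wb]. *)
Lemma prox_subgrad_dist_lim_out : ~ S wb ->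
  exists2 z, proj wb S z & q = (dist wb S)^-1 *: (wb - z).
Proof.
move=> nS; have d0 : 0 < dist wb S.
  by rewrite ltNge; apply/negP => /(dist_le0 Sc S0).
exists (wb - dist wb S *: q); last first.
  by rewrite opprB addrCA subrr addr0 scalerA mulVf ?gt_eqF // scale1r.
split; last first.
  move=> s Ss; apply: le_trans (dist_le _ Ss).
  rewrite opprB addrCA subrr addr0 enormZ (ger0_norm (ltW d0)).
  by apply: ler_piMr; [exact: ltW | exact: prox_subgrad_dist_lim_norm].
have h := vcvB UU hw (vcvZ UU (cvg_dist S0 hw) hv).
apply: (vcv_closed UU Sc _ h).
have : \forall j \near U, 0 < dist (w j) S by apply: (cvgr_gt _ (cvg_dist S0 hw)).
apply: filterS => j dj; have [y py] := exists_proj UU Uoo (w j) Sc S0.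
by rewrite (prox_subgrad_dist_out S0 dj (hp j) py) opprB addrCA subrr addr0; apply: py.1.
Qed.

Lemma prox_subgrad_dist_lim_flat : ncone_flat wb S q.
Proof.
rewrite /ncone_flat; case: asboolP => [Swb|nS].
  by split; [exact: prox_subgrad_dist_lim_in | rewrite /cball /= subr0 prox_subgrad_dist_lim_norm].
by have [z pz ->] := prox_subgrad_dist_lim_out nS; exists z.
Qed.

End DistLimits.

Lemma closed_rel_dist k (S : set 'rV[R]_k) : S !=set0 -> closed_rel (fun w a => dist w S <= a).
Proof.
move=> S0 w a h; apply/ler_addgt0Pr => e e0.
have [w' [a' [h1 h2 h3]]] := h _ (divr_gt0 e0 (ltr0Sn R 1)).
have := dist_lip w w' S0; rewrite enormBC => h4.
by move: h2; rewrite ltr_norml => /andP[_ h2]; lra.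
Qed.

Lemma closed_rel_norm k (x0 : 'rV[R]_k) g : 0 < g -> closed_rel (fun w a => g * enorm (w - x0) <= a).
Proof.
move=> g0 w a h; apply/ler_addgt0Pr => e e0.
have e1 : 0 < Num.min (e / 2) (e / 2 / g) by rewrite lt_min !divr_gt0.
have [w' [a' []]] := h _ e1.
rewrite !lt_min [_ < e / 2 / g]ltr_pdivlMr // => /andP[_ h1] /andP[h2 _] h3.
move: h2; rewrite ltr_norml => /andP[_ h2].
have := enorm_tri w' w x0; rewrite (enormBC w w') -(ler_pM2l g0) mulrDr; lra.
Qed.

(** The term [g * enorm (x - x0)] is coercive, so an exact minimizer exists and the bound holds with
    the constant [g] itself. The height is minimized too, since [h] may be infinite. *)
Lemma error_bound n (h : 'rV[R]_n -> \bar R) (S : set 'rV[R]_n) g x0 a0 :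
  closed_rel (fun x a => (h x <= a%:E)%E) -> (forall x, (0 <= h x)%E) ->
  eclosed S -> S !=set0 -> 0 < g ->
  (forall x, ~ (S x /\ (h x <= 0)%E) -> forall y, enorm y <= g ->
     ~ (exists a b, subdiff h x a /\ ncone_flat x S b /\ y = a + b)) ->
  (h x0 <= a0%:E)%E ->
  exists x, [/\ S x, (h x <= 0)%E & g * enorm (x - x0) <= a0 + dist x0 S].
Proof.
move=> hc h0 Sc S0 g0 noc hx0.
have a_ge0 x a : (h x <= a%:E)%E -> 0 <= a.
  by move=> le; have := le_trans (h0 x) le; rewrite lee_fin.
have [[x a] /= ha xmin] : exists2 P : 'rV[R]_n * R, (h P.1 <= P.2%:E)%E &
    forall Q : 'rV[R]_n * R, (h Q.1 <= Q.2%:E)%E ->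
    P.2 + dist P.1 S + g * enorm (P.1 - x0) <= Q.2 + dist Q.1 S + g * enorm (Q.1 - x0).
  apply: (@exists_min _ _ UU Uoo _ [set P : 'rV[R]_n * R | (h P.1 <= P.2%:E)%E]
    (fun P => P.2 + dist P.1 S + g * enorm (P.1 - x0)) 0 (x0, a0)) => //=.
    move=> [x a] /= /a_ge0 a1.
    by rewrite !addr_ge0 ?dist_ge0 // mulr_ge0 ?enorm_ge0 // ltW.
  move=> u c M hu uM uc.
  have b j : [/\ 0 <= (u j).2, 0 <= dist (u j).1 S & 0 <= g * enorm ((u j).1 - x0)].
    by split; [exact: a_ge0 (hu j) | exact: dist_ge0 | rewrite mulr_ge0 ?enorm_ge0 // ltW].
  have [x hx] : exists x, vcv U (fun j => (u j).1) x.
    apply: (@vcv_bounded _ _ UU _ _ (M / g + enorm x0)); near=> j.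
    have : enorm ((u j).1 - x0) <= M / g.
      by rewrite ler_pdivlMr // mulrC; have [? ? ?] := b j; have := uM j; lra.
    by have := enorm_tri x0 (u j).1 0; rewrite !subr0; lra.
  have [a ha] : exists a : R, (u j).2 @[j --> U] --> a.
    apply: (@ultra_cvg_bounded _ _ UU _ M); near=> j.
    by have [? ? ?] := b j; rewrite ger0_norm //; have := uM j; lra.
  exists (x, a) => /=; first by apply: (vcv_rclosed UU hc hx ha); near=> j; apply: hu.
  have lim : (u j).2 + dist (u j).1 S + g * enorm ((u j).1 - x0) @[j --> U] -->
      a + dist x S + g * enorm (x - x0).
    apply: cvgD; first by apply: cvgD => //; apply: cvg_dist.
    by apply: cvgM; [exact: cvg_cst | apply: (vcv_norm UU); apply: vcvB => //; apply: vcv_cst].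
  by rewrite (cvg_unique _ uc lim) //; apply: norm_hausdorff.
have [[Sx hx]|nE] := pselect (S x /\ (h x <= 0)%E).
  exists x; split=> //; have := xmin (x0, a0) hx0 => /=.
  rewrite subrr enorm0 mulr0 addr0; apply: le_trans.
  by rewrite lerDr addr_ge0 ?dist_ge0 // (a_ge0 _ _ ha).
exfalso.
have fn : h x \is a fin_num by rewrite ge0_fin_numE // (le_lt_trans ha) // ltry.
(* Minimality in the height alone forces [a] down to the value of [h]. *)
have ah : fine (h x) = a.
  apply/eqP; rewrite eq_le; apply/andP; split; first by rewrite -lee_fin fineK.
  have := xmin (x, fine (h x)); rewrite /= fineK // lexx => /(_ isT).
  by rewrite !lerD2r.
pose Ss : 'I_3 -> 'rV[R]_n -> R -> Prop := fun i => nth (fun _ _ => True)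
  [:: (fun x a => (h x <= a%:E)%E : Prop); (fun x a => dist x S <= a : Prop);
      (fun x a => g * enorm (x - x0) <= a : Prop)] i.
pose ab : 'I_3 -> R := fun i => [:: a; dist x S; g * enorm (x - x0)]`_i.
have [||||||w [v [b [hw hs]]]] := @fuzzy_sum_cvg n _ Ss x ab (fun=> 0) 1.
- exact: ltr01.
- case=> [[|[|[|//]]] i] //; [exact: closed_rel_dist | exact: closed_rel_norm].
- case=> [[|[|[|//]]] i] y b; rewrite /Ss /= => hb _.
  + exact: a_ge0 hb.
  + by apply: le_trans hb; apply: dist_ge0.
  + by apply: le_trans hb; rewrite mulr_ge0 ?enorm_ge0 // ltW.
- by case=> [[|[|[|//]]] i]; rewrite /Ss /ab /=.
- case=> [[|[|[|//]]] i] b; rewrite /Ss /ab //= => hb.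
  by rewrite -ah -lee_fin fineK.
- move=> y b _ hb; rewrite !big_ord_recl !big_ord0 /ab /= !addr0.
  have := xmin (y, b ord0) (hb ord0) => /=.
  have := hb (lift ord0 ord0); have := hb (lift ord0 (lift ord0 ord0)); rewrite /Ss /=.
  lra.
set i0 : 'I_3 := ord0; set i1 : 'I_3 := lift ord0 ord0.
set i2 : 'I_3 := lift ord0 (lift ord0 ord0).
have [w0 b0 p0] := hw i0; have [w1 b1 p1] := hw i1; have [w2 b2 p2] := hw i2.
have v1 j : enorm (v i1 j) <= 1 by apply: prox_subgrad_dist_norm (p1 j).
have v2 j : enorm (v i2 j) <= g.
  apply: (prox_subgrad_lip (p2 j) ltr01 (ltW g0)) => e _; have := (p2 j).1; rewrite /Ss /= => hb.
  apply: (@le_trans _ _ (g * (enorm (w i2 j - x0) + enorm e))).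
    by rewrite ler_pM2l // addrAC enormD.
  by rewrite mulrDr lerD2r.
have [q1 hq1] := @vcv_bounded _ _ UU _ (v i1) 1 (nearW _ v1).
have [q2 hq2] := @vcv_bounded _ _ UU _ (v i2) g (nearW _ v2).
have hq0 : vcv U (v i0) (0 - q1 - q2).
  apply: (vcv_ext _ (vcvB UU (vcvB UU hs hq1) hq2)) => j.
  by rewrite !big_ord_recl big_ord0 addr0 addrA addrAC addrK addrK.
(* The three limits add up to 0, so [- q2] is the excluded sum; its norm is at most [g] because [q2]
   comes from the norm term. *)
apply: (noc x nE (- q2)).
  by rewrite enormN; apply: (vcv_norm_le UU hq2); near=> j; apply: v2.
exists (0 - q1 - q2), q1; split; last split.
- apply: (subdiff_lim UU fn w0 _ hq0); first by rewrite ah; exact: b0.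
  by near=> j; apply: p0.
- exact: (prox_subgrad_dist_lim_flat Sc S0 w1 hq1 p1).
- by rewrite sub0r addrAC addNr sub0r.
Unshelve. all: by end_near. Qed.

End ErrorBound.

(** * The merit functions nu and mu *)

Section Merit.
Variables (R : realType) (p n m : nat) (C : set 'rV[R]_m).
Variables (f : 'rV[R]_p -> 'rV[R]_n -> 'rV[R]_n -> 'rV[R]_m).
Variable K : 'rV[R]_p -> set 'rV[R]_n.
Hypothesis Ccone : closed_convex_pointed_cone C.
Hypothesis K0 : forall xi, K xi !=set0.

Let Cclosed : eclosed C. Proof. by case: Ccone. Qed.

Let C0 : C !=set0.
Proof. by case: Ccone => _ [h _]; apply/set0P/eqP. Qed.

Lemma cone_add a b : C a -> C b -> C (a + b).
Proof.
case: Ccone => _ [_ [_ [hZ [hcvx _]]]] Ca Cb.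
have h2 : 0 <= (2^-1 : R) <= 1 by apply/andP; split; lra.
have := hZ _ 2 (hcvx a b 2^-1 Ca Cb h2) (ler0n _ 2).
rewrite scalerDr !scalerA mulfV ?pnatr_eq0 // scale1r.
have -> : 2 * (1 - 2^-1) = 1 :> R by field.
by rewrite scale1r.
Qed.

(** This monotonicity turns upper semicontinuity of [f] modulo [C] into lower semicontinuity of its
    distance to [C]: adding [c] to a point of [C] stays in [C]. *)
Lemma dist_sub_cone v c : C c -> dist v C <= dist (v - c) C.
Proof.
move=> Cc; apply: le_dist => // s Cs; rewrite -addrA -opprD.
exact/dist_le/cone_add.
Qed.

Lemma nu_leP xi x (a : R) :
  (nu C f K xi x <= a%:E)%E <-> forall z, K xi z -> dist (f xi x z) C <= a.
Proof.
split=> [h z Kz|h].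
  rewrite -lee_fin; apply: le_trans h; apply: ereal_sup_ubound.
  by exists z.
by apply: ge_ereal_sup => _ [z Kz <-]; rewrite lee_fin h.
Qed.

Lemma nu_ge0 xi x : (0 <= nu C f K xi x)%E.
Proof.
have [z Kz] := K0 xi; apply: (@le_trans _ _ (dist (f xi x z) C)%:E).
  by rewrite lee_fin dist_ge0.
by apply: ereal_sup_ubound; exists z.
Qed.

Lemma solE_nu xi x : solE C f K xi x <-> K xi x /\ (nu C f K xi x <= 0)%E.
Proof.
split=> [[Kx h]|[Kx /nu_leP h]]; split=> //.
  by apply/nu_leP => z Kz; rewrite dist_eq0 //; exact: h.
by move=> z Kz; apply: dist_le0 => //; apply: h.
Qed.

(** Lower semicontinuity of [K] moves each [z] of [K xi] to a nearby [z'] of [K xi'], where the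
    bound [a'] holds; [dist_sub_cone] carries that bound back to [z]. *)
Lemma nu_closed : lsc_map K -> C_usc C f ->
  closed_rel (fun w a => (uncurry2 (nu C f K) w <= a%:E)%E).
Proof.
move=> Klsc fusc w a h; apply/nu_leP => z Kz; apply/ler_addgt0Pr => e e0.
set xi := lsubmx w in Kz *; set x := rsubmx w in Kz *.
have e2 : 0 < e / 2 by rewrite divr_gt0.
have oball k (c : 'rV[R]_k) d : eopen [set y | enorm (y - c) < d].
  move=> y /= yd; exists (d - enorm (y - c)); first by rewrite subr_gt0.
  by move=> y' h'; have := enorm_tri y y' c; lra.
have fb : [set y | enorm (y - f xi x z) < e / 2] (f xi x z) by rewrite /= subrr enorm0.
have [d d0 hd] := fusc xi x z _ (oball _ _ _) fb.
(* One third for [w' - w] and one for [z' - z] stay together below [d]. *)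
have d3 : 0 < d / 3 by rewrite divr_gt0.
have Kb : K xi `&` [set y | enorm (y - z) < d / 3] !=set0.
  by exists z; split=> //=; rewrite subrr enorm0.
have [d' d'0 hK] := Klsc xi _ (oball _ _ _) Kb.
have em : 0 < Num.min (e / 2) (Num.min d' (d / 3)) by rewrite !lt_min e2 d'0.
have [w' [a' []]] := h _ em; rewrite !lt_min => /and3P[_ wd' wd] /andP[ae _] /nu_leP ha.
have wE : enorm (lsubmx w' - xi) <= enorm (w' - w).
  rewrite -[X in X <= _]/(enorm (lsubmx w' - lsubmx w)).
  by rewrite {2}(pr_eta w') {2}(pr_eta w) prB enorm_prl.
have [z' [Kz' zz']] := hK _ (le_lt_trans wE wd').
have : enorm (pr (pr (lsubmx w' - xi) (rsubmx w' - x)) (z' - z)) < d.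
  apply: le_lt_trans (enorm_pr_le _ _) _.
  have -> : pr (lsubmx w' - xi) (rsubmx w' - x) = w' - w.
    by rewrite -prB -!pr_eta.
  by move: zz' => /=; lra.
move=> /hd [v [c [/= vf [Cc fE]]]].
have h1 := dist_lip (f xi x z) v C0; have h2 := dist_sub_cone v Cc.
have h3 := ha _ Kz'; rewrite fE in h3; rewrite enormBC in vf.
by move: ae; rewrite ltr_norml => /andP[_ ae]; lra.
Qed.

Lemma nu_closed_slice xi : lsc_map K -> C_usc C f ->
  closed_rel (fun x a => (nu C f K xi x <= a%:E)%E).
Proof.
move=> Klsc fusc x a h.
have := nu_closed Klsc fusc (w := pr xi x) (a := a).
rewrite /uncurry2 lsubmx_pr rsubmx_pr; apply=> e /h [x' [a' [h1 h2 h3]]].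
by exists (pr xi x'), a'; rewrite prB subrr enorm_pr0l lsubmx_pr rsubmx_pr.
Qed.

End Merit.

(** * Distance to the values of K and normals to its graph *)

Section GraphDistance.
Variables (R : realType) (U : set_system nat).
Hypotheses (UU : UltraFilter U) (Uoo : \oo `<=` U).
Variables (p n : nat) (K : 'rV[R]_p -> set 'rV[R]_n).
Hypotheses (Kclosed : eclosed (gph K)) (K0 : forall xi, K xi !=set0).

Definition mu_le (w : 'rV[R]_(p + n)) (a : R) : Prop := dist (rsubmx w) (K (lsubmx w)) <= a.

Lemma gph_pr xi y : gph K (pr xi y) <-> K xi y.
Proof.
split=> [[a [b [Kab e]]]|h]; last by exists xi, y.
have := congr1 (@lsubmx _ _ _ _) e; have := congr1 (@rsubmx _ _ _ _) e.
by rewrite /= !lsubmx_pr !rsubmx_pr => -> ->.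
Qed.

Lemma closed_value xi : eclosed (K xi).
Proof.
move=> y h; apply/gph_pr; apply: Kclosed => e /h [s Ks lt].
by exists (pr xi s); [apply/gph_pr | rewrite prB subrr enorm_pr0l].
Qed.

Lemma vcv_lsubmx (w : nat -> 'rV[R]_(p + n)) l : vcv U w l ->
  vcv U (fun j => lsubmx (w j)) (lsubmx l).
Proof.
move=> h; apply: (@vcv_le _ _ UU _ _ _ (fun j => enorm (w j - l))) => //.
by near=> j; rewrite [w j in leRHS]pr_eta [l in leRHS]pr_eta prB enorm_prl.
Unshelve. all: by end_near. Qed.

Lemma vcv_rsubmx (w : nat -> 'rV[R]_(p + n)) l : vcv U w l ->
  vcv U (fun j => rsubmx (w j)) (rsubmx l).
Proof.
move=> h; apply: (@vcv_le _ _ UU _ _ _ (fun j => enorm (w j - l))) => //.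
by near=> j; rewrite [w j in leRHS]pr_eta [l in leRHS]pr_eta prB enorm_prr.
Unshelve. all: by end_near. Qed.

(** The projections onto the nearby values of [K] are bounded through the heights; their limit is in
    [K (lsubmx w)] by closedness of the graph and bounds the distance there. *)
Lemma mu_closed : closed_rel mu_le.
Proof.
move=> w a h.
have /choice [P hP] : forall j : nat, exists P : 'rV[R]_(p + n) * R,
    [/\ enorm (P.1 - w) < j.+1%:R^-1, `|P.2 - a| < j.+1%:R^-1 & mu_le P.1 P.2].
  by move=> j; have [w' [a' ?]] := h _ (@invSn_gt0 R j); exists (w', a').
have hw : vcv U (fun j => (P j).1) w.
  apply: (@vcv_le _ _ UU _ _ _ (fun j => j.+1%:R^-1)); last exact: cvg_invSn.
  by near=> j; have [/ltW] := hP j.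
have /cvgrPdist_lt inv0 := @cvg_invSn R U UU Uoo.
have ha : (P j).2 @[j --> U] --> a.
  apply/cvgrPdist_lt => e /inv0; apply: filterS => j.
  by rewrite sub0r normrN ger0_norm // distrC; apply: lt_trans; have [] := hP j.
have /choice [y hy] := fun j => exists_proj UU Uoo (rsubmx (P j).1)
  (@closed_value (lsubmx (P j).1)) (K0 (lsubmx (P j).1)).
have ya j : enorm (rsubmx (P j).1 - y j) <= (P j).2.
  by rewrite -(dist_proj (hy j)); have [] := hP j.
have [l hl] : exists l, vcv U y l.
  have hr := vcv_near_bounded UU (vcv_rsubmx hw).
  have hb : \forall j \near U, `|(P j).2| <= `|a| + 1.
    by apply: (cvgr_le _ (cvg_norm ha)); rewrite ltrDl.
  apply: (@vcv_bounded _ _ UU _ _ (enorm (rsubmx w) + 1 + (`|a| + 1))).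
  apply: filterS (filterI hr hb) => j [h1 h2].
  have := enorm_tri (rsubmx (P j).1) (y j) 0; rewrite !subr0 enormBC.
  by have := ya j; have := ler_norm (P j).2; lra.
have Kl : K (lsubmx w) l.
  apply/gph_pr; apply: (vcv_closed UU Kclosed _ (vcv_pr UU (vcv_lsubmx hw) hl)).
  by near=> j; apply/gph_pr; apply: (hy j).1.
apply: le_trans (dist_le _ Kl) _.
apply: (ler_cvg_to (vcv_norm UU (vcvB UU (vcv_rsubmx hw) hl)) ha).
by near=> j; apply: ya.
Unshelve. all: by end_near. Qed.

(* Translating x along with its projection y does not increase the distance
   |x - y|, so a proximal subgradient of the distance at (xi, x) is a proximal
   normal to the graph at (xi, y). *)
Lemma prox_subgrad_mu_gph w a v y : prox_subgrad mu_le w a v -> proj (rsubmx w) (K (lsubmx w)) y ->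
  prox_normal (gph K) (pr (lsubmx w) y) v.
Proof.
move=> [Sa [sg [d [d0 H]]]] py; split; first by apply/gph_pr; exact: py.1.
exists sg, d; split=> // s' Ks' le.
have := H (w + (s' - pr (lsubmx w) y)) a _; rewrite [w + _]addrC addrK subrr add0r.
apply=> //; apply: le_trans Sa; rewrite (dist_proj py).
case: Ks' => xi' [y' [Ky' ->]].
have -> : pr xi' y' - pr (lsubmx w) y + w = pr xi' (y' - y + rsubmx w).
  by rewrite {2}(pr_eta w) prB prD subrK.
rewrite /mu_le lsubmx_pr rsubmx_pr; apply: le_trans (dist_le _ Ky') _.
suff -> : y' - y + rsubmx w - y' = rsubmx w - y by [].
by rewrite addrC -addrA addrCA !addrA subrr add0r addrC.
Qed.

(** For fixed xi the distance is 1-Lipschitz in x, so the test direction is [(0, rsubmx v)]. *)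
Lemma prox_subgrad_mu_norm w a v : prox_subgrad mu_le w a v -> enorm (rsubmx v) <= 1.
Proof.
move=> H; have := enorm_ge0 (rsubmx v); rewrite le_eqVlt => /predU1P[<-//|v0].
rewrite -(ler_pM2r v0) mul1r -expr2 enorm_sqr.
have -> : dot (rsubmx v) (rsubmx v) = dot v (pr 0 (rsubmx v)).
  rewrite {3}(pr_eta v) dot_pr -[LHS]add0r; congr (_ + _).
  by rewrite /dot big1 // => i _; rewrite !mxE mulr0.
apply: (prox_subgrad_dir H ltr01) => t t0 _; have := H.1; rewrite /mu_le => Ha.
have -> : w + t *: pr 0 (rsubmx v) = pr (lsubmx w) (rsubmx w + t *: rsubmx v).
  by rewrite {1}(pr_eta w) prZ prD scaler0 addr0.
rewrite lsubmx_pr rsubmx_pr; apply: le_trans (dist_lip _ (rsubmx w) (K0 _)) _.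
by rewrite [_ + t *: _]addrC addrK enormZ gtr0_norm // lerD2r.
Qed.

(** The weights [t] allow both later uses, unscaled and normalized subgradients. Heights tending to
    0 bring the projections back to the second component of [wb]. *)
Lemma prox_subgrad_mu_lim wb (w v : nat -> 'rV[R]_(p + n)) (a t : nat -> R) q :
  gph K wb -> vcv U w wb -> a j @[j --> U] --> (0 : R) ->
  (\forall j \near U, 0 <= t j) -> (forall j, prox_subgrad mu_le (w j) (a j) (v j)) ->
  vcv U (fun j => t j *: v j) q -> ncone wb (gph K) q.
Proof.
move=> Kwb hw ha ht hp hv.
have /choice [y hy] := fun j => exists_proj UU Uoo (rsubmx (w j))
  (@closed_value (lsubmx (w j))) (K0 (lsubmx (w j))).
apply: (ncone_lim UU Kwb _ hv (s := fun j => pr (lsubmx (w j)) (y j))).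
  apply: (@vcv_le _ _ UU _ _ _ (fun j => enorm (w j - wb) + a j)); last first.
    by rewrite -[X in _ --> X]addr0; apply: cvgD.
  near=> j; apply: le_trans (enorm_tri (w j) _ _) _; rewrite addrC lerD2l.
  rewrite {2}(pr_eta (w j)) prB subrr enorm_pr0l enormBC -(dist_proj (hy j)).
  exact: (hp j).1.
by apply: filterS ht => j tj; apply: prox_normal_scale => //;
  apply: prox_subgrad_mu_gph (hp j) (hy j).
Unshelve. all: by end_near. Qed.

End GraphDistance.

(** Projecting onto the cylinder leaves the second component unchanged, as restoring that component
    only shortens the distance. *)
Lemma ncone_cylinder (R : realType) p n (Omega : set 'rV[R]_p) (xib : 'rV[R]_p)
    (xb : 'rV[R]_n) (q : 'rV[R]_(p + n)) :
  ncone (pr xib xb) [set w : 'rV[R]_(p + n) | Omega (lsubmx w)] q ->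
  ncone xib Omega (lsubmx q) /\ rsubmx q = 0.
Proof.
move=> [/= Ob [x [w [hx [hw hc]]]]]; rewrite lsubmx_pr in Ob.
have projE z y : proj z [set w : 'rV[R]_(p + n) | Omega (lsubmx w)] y ->
    proj (lsubmx z) Omega (lsubmx y) /\ rsubmx z - rsubmx y = 0.
  move=> [/= Oy hy]; have sq s : Omega s ->
      enorm (lsubmx z - lsubmx y) ^+ 2 + enorm (rsubmx z - rsubmx y) ^+ 2
      <= enorm (lsubmx z - s) ^+ 2.
    move=> Os; have := hy (pr s (rsubmx z)); rewrite /= lsubmx_pr => /(_ Os).
    have -> : z - y = pr (lsubmx z - lsubmx y) (rsubmx z - rsubmx y).
      by rewrite -prB -!pr_eta.
    have -> : z - pr s (rsubmx z) = pr (lsubmx z - s) 0.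
      by rewrite {1}(pr_eta z) prB subrr.
    rewrite enorm_pr0r.
    by rewrite -(@ler_pXn2r _ 2) ?nnegrE ?enorm_ge0 // enorm_pr.
  split; last by apply: enorm_sqr_le0; have := sq _ Oy; lra.
  split=> // s /sq h; rewrite -(@ler_pXn2r _ 2) ?nnegrE ?enorm_ge0 //.
  by apply: le_trans h; rewrite lerDl sqr_ge0.
have conv_l e : 0 < e -> exists N, forall j, (N <= j)%N ->
    enorm (lsubmx (w j) - lsubmx q) < e /\ enorm (rsubmx (w j) - rsubmx q) < e.
  move=> /hw [N hN]; exists N => j /hN; rewrite {1}(pr_eta (w j)) {1}(pr_eta q) prB.
  by move=> h; split; apply: le_lt_trans h; [exact: enorm_prl | exact: enorm_prr].
have wE j : exists t y, [/\ 0 <= t, proj (x j) [set w : 'rV[R]_(p + n) | Omega (lsubmx w)] y &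
    w j = t *: (x j - y)].
  by have [t [_ [t0 [[y py <-] ->]]]] := hc j; exists t, y.
split; last first.
  apply: enorm_le_eps => e /conv_l [N hN]; have [_] := hN N (leqnn N).
  have [t [y [_ /projE[_ h0] ->]]] := wE N.
  by rewrite [x N]pr_eta [y]pr_eta prB prZ rsubmx_pr h0 scaler0 sub0r enormN => /ltW.
split=> //; exists (fun j => lsubmx (x j)), (fun j => lsubmx (w j)); split.
  move=> e /hx [N hN]; exists N => j /hN; apply: le_lt_trans.
  by rewrite [x j in leRHS]pr_eta prB enorm_prl.
split; first by move=> e /conv_l [N hN]; exists N => j /hN [].
move=> j; have [t [y [t0 /projE[py _] ->]]] := wE j.
exists t, (lsubmx (x j) - lsubmx y); split=> //; split; first by exists (lsubmx y).
by rewrite [x j in LHS]pr_eta [y in LHS]pr_eta prB prZ lsubmx_pr.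
Qed.

Lemma exact_penalty (R : realType) k (g : 'rV[R]_k -> R) (W : set 'rV[R]_k) wb L r :
  0 <= L -> 0 < r -> W wb ->
  (forall u, W u -> enorm (u - wb) <= 3 * r -> g wb <= g u) ->
  (forall w1 w2, cball wb (3 * r) w1 -> cball wb (3 * r) w2 ->
     `|g w1 - g w2| <= L * enorm (w1 - w2)) ->
  forall w, enorm (w - wb) <= r -> g wb <= g w + L * dist w W.
Proof.
move=> L0 r0 Wwb gmin glip w wr; apply/ler_addgt0Pr => e e0.
have L1 : 0 < L + 1 by rewrite ltr_wpDl.
have e1 : 0 < Num.min (e / (L + 1)) r by rewrite lt_min r0 divr_gt0.
have W0 : W !=set0 by exists wb.
have [s Ws] := dist_approx w W0 e1.
set d := Num.min _ _ => hs.
have dr : d <= r by rewrite ge_min lexx orbT.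
have de : d * (L + 1) <= e by rewrite -ler_pdivlMr // ge_min lexx.
have d0 := dist_le w Wwb.
(* The point [s] is within [dist w W + d <= 2 * r] of [w], whence the radius [3 * r]. *)
have sr : enorm (s - wb) <= 3 * r.
  by have := enorm_tri w s wb; rewrite (enormBC s w); lra.
have := glip w s; rewrite /cball /= => /(_ _ sr) h.
have {h} : `|g w - g s| <= L * enorm (w - s) by apply: h; lra.
rewrite ler_norml => /andP[h _]; have h1 := gmin _ Ws sr.
have : L * enorm (w - s) <= L * (dist w W + d) by rewrite ler_wpM2l // ltW.
have : 0 <= d by rewrite ltW.
rewrite mulrDr; rewrite mulrDr mulr1 (mulrC d) in de; lra.
Qed.

Lemma closed_rel_scale (R : realType) k (S : 'rV[R]_k -> R -> Prop) c : 0 < c ->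
  closed_rel S -> closed_rel (fun w a => S w (a / c)).
Proof.
move=> c0 Sc w a h; apply: Sc => e e0.
have e1 : 0 < Num.min e (e * c) by rewrite lt_min e0 mulr_gt0.
have [w' [a' []]] := h _ e1; rewrite !lt_min => /andP[h1 _] /andP[_ h2] h3.
exists w', (a' / c); split=> //.
by rewrite -mulrBl normrM (@ger0_norm _ c^-1) ?invr_ge0 ?ltW // ltr_pdivrMr.
Qed.

Unset Implicit Arguments.

Theorem mainTheorem10 (R : realType) (p n m : nat)
  (C : set 'rV[R]_m)
  (f : 'rV[R]_p -> 'rV[R]_n -> 'rV[R]_n -> 'rV[R]_m)
  (K : 'rV[R]_p -> set 'rV[R]_n)
  (phi : 'rV[R]_p -> 'rV[R]_n -> R)
  (Omega : set 'rV[R]_p)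
  (xib : 'rV[R]_p) (xb : 'rV[R]_n) (rho gamma : R) :
  (* standing assumptions *)
  closed_convex_pointed_cone C ->
  eclosed (gph K) ->
  (forall xi, K xi !=set0) ->
  eclosed Omega ->
  (* (xib, xb) in gph E, xib in Omega, local solution of (MPEC) *)
  solE C f K xib xb ->
  Omega xib ->
  (exists2 r, 0 < r & forall xi x, Omega xi -> solE C f K xi x ->
      enorm (pr (xi - xib) (x - xb)) <= r -> phi xib xb <= phi xi x) ->
  0 < rho ->
  (* (i) *)
  loc_lipschitz (uncurry2 phi) (pr xib xb) ->
  (* (ii) *)
  lsc_map K -> usc_map K ->
  (* (iii) *)
  subtransversal [set w : 'rV[R]_(p + n) | Omega (lsubmx w)]
                 (gph (solE C f K)) (pr xib xb) ->
  (* (iv) *)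
  C_usc C f ->
  (* (v) *)
  [set w : 'rV[R]_(p + n) |
     subdiff_inf (uncurry2 (nu C f K)) (pr xib xb) (- w) /\
     coderiv_ball K xib xb (lsubmx w) /\ enorm (rsubmx w) <= 1] = [set 0] ->
  (* (vi) *)
  (forall xi, cball xib rho xi ->
     exists2 x0, K xi x0 & C_bounded C [set f xi x0 z | z in K xi]) ->
  (* (vii) *)
  0 < gamma ->
  (forall xi, cball xib rho xi -> forall x, ~ solE C f K xi x ->
     forall y, enorm y <= gamma ->
       ~ (exists a b, subdiff (nu C f K xi) x a /\ ncone_flat x (K xi) b /\ y = a + b)) ->
  exists2 lam, 0 < lam &
    exists a b c d1 d2,
      subdiff (fun w => (uncurry2 phi w)%:E) (pr xib xb) a /\
      ncone xib Omega b /\ enorm b <= 1 /\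
      subdiff (uncurry2 (nu C f K)) (pr xib xb) c /\
      coderiv_ball K xib xb d1 /\ enorm d2 <= 1 /\
      0 = a + lam *: pr b (0 : 'rV[R]_n) + (lam / gamma) *: (c + pr d1 d2).
Proof.
move=> Ccone Kcl K0 Ocl Eb Ob [r2 r20 locmin] rho0 [L0 [r1 [r10 lip0]]] Klsc _.
move=> [kap [r3 [kap0 [r30 subt]]]] fusc qual _ g0 noncrit.
have [U [UU Uoo]] := exists_ultra_infty.
set wb := pr xib xb.
set Ot : set 'rV[R]_(p + n) := [set w | Omega (lsubmx w)].
set E := solE C f K.
set nuw := uncurry2 (nu C f K).
pose L := `|L0| + 1.
have L_gt0 : 0 < L by rewrite ltr_wpDl.
have lip w1 w2 : cball wb r1 w1 -> cball wb r1 w2 ->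
    `|uncurry2 phi w1 - uncurry2 phi w2| <= L * enorm (w1 - w2).
  move=> h1 h2; apply: le_trans (lip0 _ _ h1 h2) _; rewrite ler_wpM2r ?enorm_ge0 //.
  by rewrite /L; have := ler_norm L0; lra.
pose lam := L * kap.
have lam0 : 0 < lam by rewrite mulr_gt0.
(* Multiplied by [c], the penalized inequality has coefficient one on nu and mu, and [gamma] on the
   distance to [Ot]. *)
pose c := gamma / lam.
have c0 : 0 < c by rewrite divr_gt0.
have Kb : K xib xb by case: Eb.
have Kwb : gph K wb by apply/gph_pr.
have Owb : Ot wb by rewrite /Ot /= lsubmx_pr.
have Ot0 : Ot !=set0 by exists wb.
have Otcl : eclosed Ot.
  move=> w h; apply: Ocl => e /h [s Os lt]; exists (lsubmx s) => //.
  by apply: le_lt_trans lt; rewrite {2}(pr_eta w) {2}(pr_eta s) prB enorm_prl.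
have nu0 : nuw wb = 0%E.
  apply/eqP; rewrite eq_le /nuw /uncurry2 lsubmx_pr rsubmx_pr nu_ge0 // andbT.
  by apply: ((solE_nu f K Ccone xib xb).1 Eb).2.
have gphE w : gph E w <-> E (lsubmx w) (rsubmx w) by rewrite {1}(pr_eta w); apply: gph_pr.
have Ewb : gph E wb by apply/gphE; rewrite lsubmx_pr rsubmx_pr.
(* The division by 3 is for [exact_penalty], which needs minimality and the Lipschitz bound up to
   [3 * r]. *)
pose r := Num.min (Num.min r1 r2) (Num.min r3 rho) / 3.
have r0 : 0 < r by rewrite divr_gt0 // !lt_min r10 r20 r30 rho0.
have r3E : 3 * r = Num.min (Num.min r1 r2) (Num.min r3 rho) by rewrite /r; field.
have rr1 : 3 * r <= r1 by rewrite r3E !ge_min lexx.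
have rr2 : 3 * r <= r2 by rewrite r3E !ge_min lexx !orbT.
have rr3 : 3 * r <= r3 by rewrite r3E !ge_min lexx !orbT.
have rr4 : 3 * r <= rho by rewrite r3E !ge_min lexx !orbT.
have wbE w : w - wb = pr (lsubmx w - xib) (rsubmx w - xb) by rewrite {1}(pr_eta w) prB.

(* Error bound and penalized inequality near [wb] *)
have errb w a : enorm (w - wb) <= r -> (nuw w <= a%:E)%E ->
    dist w (gph E) <= (a + dist (rsubmx w) (K (lsubmx w))) / gamma.
  move=> wr hnu; set xi := lsubmx w; set x := rsubmx w.
  have xir : cball xib rho xi.
    have := enorm_prl (lsubmx w - xib) (rsubmx w - xb); rewrite -wbE /cball /=; lra.
  have [y [Ky ny hy]] := error_bound UU Uoo (nu_closed_slice Ccone (xi := xi) Klsc fusc)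
    (fun x => nu_ge0 f Ccone K0 xi x) (@closed_value _ _ _ _ Kcl xi) (K0 xi) g0
    (fun x nE => noncrit xi xir x (fun h => nE ((solE_nu f K Ccone xi x).1 h))) hnu.
  rewrite ler_pdivlMr // mulrC; apply: le_trans hy; rewrite ler_pM2l //.
  have Ey : gph E (pr xi y) by apply/gph_pr/(solE_nu f K Ccone).
  apply: le_trans (dist_le _ Ey) _.
  by rewrite {1}(pr_eta w) prB subrr enorm_pr0l enormBC.
have pen w a : enorm (w - wb) <= r -> (nuw w <= a%:E)%E ->
    uncurry2 phi wb <= uncurry2 phi w
      + lam * (dist w Ot + (a + dist (rsubmx w) (K (lsubmx w))) / gamma).
  move=> wr hnu.
  have gmin u : (Ot `&` gph E) u -> enorm (u - wb) <= 3 * r ->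
      uncurry2 phi wb <= uncurry2 phi u.
    move=> [Ou /gphE Eu] ur; rewrite /uncurry2 lsubmx_pr rsubmx_pr; apply: locmin => //.
    by rewrite -wbE (le_trans ur).
  have glip w1 w2 : cball wb (3 * r) w1 -> cball wb (3 * r) w2 ->
      `|uncurry2 phi w1 - uncurry2 phi w2| <= L * enorm (w1 - w2).
    by move=> h1 h2; apply: lip; [apply: le_trans h1 rr1 | apply: le_trans h2 rr1].
  apply: le_trans (exact_penalty (ltW L_gt0) r0 (conj Owb Ewb) gmin glip wr) _.
  rewrite lerD2l /lam -mulrA ler_pM2l //.
  have wr3 : cball wb r3 w by rewrite /cball /=; lra.
  apply: le_trans (subt w wr3) _; rewrite ler_pM2l // ge_max.
  have h1 := errb w a wr hnu; have h2 := dist_ge0 w Ot0.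
  have h3 : 0 <= dist w (gph E) by apply: dist_ge0; exists wb.
  by apply/andP; split; lra.
(* phi is Lipschitz, hence has a closed epigraph, only near wb. *)
pose Sphi (w : 'rV[R]_(p + n)) (a : R) : Prop :=
  uncurry2 phi w <= a /\ enorm (w - wb) <= r1.
(* Epigraphs of [c] times phi (cut to a ball), [gamma] times the distance to [Ot], nu and mu. *)
pose Ss : 'I_4 -> 'rV[R]_(p + n) -> R -> Prop := fun i => nth (fun _ _ => True)
  [:: (fun w a => Sphi w (a / c)); (fun w a => dist w Ot <= a / gamma : Prop);
      (fun w a => (nuw w <= a%:E)%E : Prop); mu_le K] i.
pose ab : 'I_4 -> R := fun i => [:: c * uncurry2 phi wb; 0; 0; 0]`_i.
pose B : 'I_4 -> R := fun i => [:: c * (uncurry2 phi wb - L * r); 0; 0; 0]`_i.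
have mu_ge0 w a : mu_le K w a -> 0 <= a by apply: le_trans; apply: dist_ge0.
have nuw_ge0 w a : (nuw w <= a%:E)%E -> 0 <= a.
  by move=> h; rewrite -lee_fin (le_trans _ h) // nu_ge0.
have cphi : c * uncurry2 phi wb / c = uncurry2 phi wb.
  by rewrite mulrC mulKf // gt_eqF.
have [||||||w [v [a [hw hs]]]] := @fuzzy_sum_cvg R U UU Uoo (p + n) _ Ss wb ab B r.
- exact: r0.
- case=> [[|[|[|[|//]]]] i] /=.
  + apply: closed_rel_scale => // w a h; split; last first.
      apply/ler_addgt0Pr => e e0; have [w' [a' [h1 _ [_ h3]]]] := h _ e0.
      by have := enorm_tri w' w wb; rewrite (enormBC w w'); lra.
    apply/ler_addgt0Pr => e e0.
    have wr1 : enorm (w - wb) <= r1.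
      apply/ler_addgt0Pr => e' e'0; have [w' [a' [h1 _ [_ h3]]]] := h _ e'0.
      by have := enorm_tri w' w wb; rewrite (enormBC w w'); lra.
    have e1 : 0 < Num.min (e / 2) (e / 2 / L) by rewrite lt_min !divr_gt0.
    have [w' [a' []]] := h _ e1; rewrite !lt_min [_ < e / 2 / L]ltr_pdivlMr //.
    move=> /andP[_ h1] /andP[h2 _] [h3 h4].
    move: h2 (lip w' w h4 wr1); rewrite !ler_norml ltr_norml => /andP[_ h2] /andP[h5 _].
    by rewrite mulrC in h1; lra.
  + by apply: (closed_rel_scale (S := fun w a => dist w Ot <= a)) => //; apply: closed_rel_dist.
  + exact: (nu_closed Ccone Klsc fusc).
  + exact: (mu_closed UU Uoo Kcl K0).
- case=> [[|[|[|[|//]]]] i] w a; rewrite /Ss /B /=.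
  + move=> [h1 h2] wr; rewrite ler_pdivlMr // mulrC in h1; apply: le_trans h1.
    rewrite ler_pM2l //.
    have wbr : cball wb r1 wb by rewrite /cball /= subrr enorm0 ltW.
    move: (lip w wb h2 wbr); rewrite ler_norml => /andP[h3 _].
    have : L * enorm (w - wb) <= L * r by rewrite ler_pM2l.
    lra.
  + by move=> h _; rewrite ler_pdivlMr // in h; apply: le_trans h; rewrite mulr_ge0 ?dist_ge0 ?ltW.
  + by move=> /nuw_ge0.
  + by move=> /mu_ge0.
- case=> [[|[|[|[|//]]]] i]; rewrite /Ss /ab /=.
  + by rewrite /Sphi cphi subrr enorm0; split=> //; apply: ltW.
  + by rewrite mul0r dist_eq0.
  + by rewrite nu0.
  + by rewrite /mu_le lsubmx_pr rsubmx_pr dist_eq0.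
- case=> [[|[|[|[|//]]]] i] a; rewrite /Ss /ab /=.
  + by move=> [h1 _]; rewrite ler_pdivlMr // mulrC in h1.
  + by rewrite ler_pdivlMr // dist_eq0 // mul0r.
  + by move=> /nuw_ge0.
  + by move=> /mu_ge0.
- move=> w a wr hS; rewrite !big_ord_recl !big_ord0 /ab /= !addr0.
  have := hS ord0; have := hS (lift ord0 ord0); have := hS (lift ord0 (lift ord0 ord0)).
  have := hS (lift ord0 (lift ord0 (lift ord0 ord0))); rewrite /Ss /mu_le /=.
  set a0 := a ord0; set a1 := a _; set a2 := a _; set a3 := a _.
  move=> h3 h2 h1 [h0 _].
  have := pen w a2 wr h2; rewrite -(ler_pM2l c0) mulrDr.
  have -> : c * (lam * (dist w Ot + (a2 + dist (rsubmx w) (K (lsubmx w))) / gamma)) =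
    gamma * dist w Ot + (a2 + dist (rsubmx w) (K (lsubmx w))).
    by rewrite /c; field; rewrite !gt_eqF.
  rewrite ler_pdivlMr // mulrC in h0; rewrite ler_pdivlMr // mulrC in h1; lra.

(* Limits of the bounded subgradients *)
set i0 : 'I_4 := ord0; set i1 : 'I_4 := lift ord0 ord0.
set i2 : 'I_4 := lift ord0 (lift ord0 ord0).
set i3 : 'I_4 := lift ord0 (lift ord0 (lift ord0 ord0)).
have [w0 a0 p0] := hw i0; have [w1 a1 p1] := hw i1.
have [w2 a2 p2] := hw i2; have [w3 a3 p3] := hw i3.
(* Strictly inside the ball the cut in [Sphi] is inactive for a smaller [d], so these are
   subgradients of phi itself. *)
have q0p : \forall j \near U, prox_subgrad (fun w a => (((uncurry2 phi w)%:E : \bar R) <= a%:E)%E)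
    (w i0 j) (a i0 j / c) (c^-1 *: v i0 j) /\ enorm (c^-1 *: v i0 j) <= L.
  have := (vcvP UU _ _).1 w0 r1 r10; apply: filterS => j wj.
  have H := prox_subgrad_scale c0 (p0 j); have [[S1 S2] [sg [d [d0 Hd]]]] := H.
  have dd : 0 < r1 - enorm (w i0 j - wb) by rewrite subr_gt0.
  split.
    split; first by rewrite lee_fin.
    exists sg, (Num.min d (r1 - enorm (w i0 j - wb))); split; first by rewrite lt_min d0.
    move=> w' a'; rewrite lee_fin le_min => ha' /andP[h1 h2]; apply: Hd => //; split=> //.
    by have := enorm_tri (w i0 j) w' wb; lra.
  apply: (prox_subgrad_lip H dd (ltW L_gt0)) => h hd.
  have wh : enorm (w i0 j + h - wb) <= r1.
    by rewrite addrAC; have := enormD (w i0 j - wb) h; lra.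
  split=> //; have := lip _ _ wh (ltW wj : cball wb r1 (w i0 j)).
  by rewrite [w i0 j + h]addrC addrK ler_norml => /andP[_]; lra.
have [q0 hq0] : exists q, vcv U (fun j => c^-1 *: v i0 j) q.
  by apply: (@vcv_bounded _ _ UU _ _ L); apply: filterS q0p => j [].
have q1p j :
    prox_subgrad (fun w a => dist w Ot <= a) (w i1 j) (a i1 j / gamma) (gamma^-1 *: v i1 j).
  exact: (prox_subgrad_scale (S := fun w a => dist w Ot <= a) g0 (p1 j)).
have [q1 hq1] : exists q, vcv U (fun j => gamma^-1 *: v i1 j) q.
  apply: (@vcv_bounded _ _ UU _ _ 1); apply: nearW => j.
  by apply: prox_subgrad_dist_norm (q1p j).
have [bO q1r] := ncone_cylinder (prox_subgrad_dist_lim_in UU Uoo Otcl Ot0 w1 hq1 q1p Owb).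
have q1n := prox_subgrad_dist_lim_norm UU Ot0 hq1 q1p.
have cst (x : R) : (x : R) @[_ --> U] --> x by apply: cvg_cst.
pose g := c *: q0 + gamma *: q1.
(* For nu and mu only the sum is controlled at this stage. *)
have hg : vcv U (fun j => v i2 j + v i3 j) (- g).
  have := vcvB UU hs (vcvD UU (vcvZ UU (cst c) hq0) (vcvZ UU (cst gamma) hq1)).
  rewrite sub0r; apply: vcv_ext => j.
  rewrite !scalerA !mulfV ?gt_eqF // !scale1r !big_ord_recl big_ord0 addr0.
  by rewrite addrA [_ + _ + (_ + _)]addrC addrK.
have nufin : nuw wb \is a fin_num by rewrite nu0.
have [[M v2M]|v2inf] := ultra_bounded_or UU (fun j => enorm (v i2 j)).

  (* Bounded subgradients of nu: the multiplier rule *)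
  have [q2 hq2] := vcv_bounded UU v2M.
  have hq3 : vcv U (v i3) (- g - q2).
    by apply: (vcv_ext _ (vcvB UU hg hq2)) => j; rewrite addrAC subrr add0r.
  set q3 := - g - q2 in hq3.
  have q3r : enorm (rsubmx q3) <= 1.
    apply: (vcv_norm_le UU (vcv_rsubmx UU hq3)); near=> j.
    exact: (prox_subgrad_mu_norm K0 (p3 j)).
  have q3N : ncone wb (gph K) q3.
    apply: (prox_subgrad_mu_lim UU Uoo Kcl K0 Kwb w3 a3 (t := fun=> 1) _ p3).
      by near=> j.
    by apply: vcv_ext hq3 => j; rewrite scale1r.
  exists lam => //; exists q0, (lsubmx q1), q2, (lsubmx q3), (rsubmx q3); split.
    apply: (subdiff_lim UU (a := fun j => a i0 j / c) _ w0 _ hq0) => //.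
      rewrite -[X in _ --> X]cphi; apply: cvgM; last exact: cst.
      exact: a0.
    by apply: filterS q0p => j [].
  split=> //; split; first by apply: le_trans (enorm_lsubmx _) q1n.
  split.
    apply: (subdiff_lim UU nufin w2 _ hq2); first by rewrite nu0; exact: a2.
    by near=> j; apply: p2.
  (* The coderivative reads the normal as [(u, - v)], hence the sign of the witness. *)
  split; first by exists (- rsubmx q3); rewrite ?enormN // /coderiv /= opprK -pr_eta.
  split=> //.
  have -> : pr (lsubmx q1) 0 = q1 by rewrite -q1r -pr_eta.
  rewrite -pr_eta /q3 addrCA subrr addr0 /g scalerN scalerDr !scalerA.
  have -> : lam / gamma * c = 1 by rewrite /c; field; rewrite !gt_eqF.
  by rewrite divfK ?gt_eqF // scale1r subrr.

(* Unbounded subgradients of nu: contradiction with (v) *)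
pose t j := (enorm (v i2 j))^-1.
have t0 j : 0 <= t j by rewrite invr_ge0 enorm_ge0.
have tcv : t j @[j --> U] --> (0 : R).
  apply/cvgr0Pnorm_lt => e e0; have := v2inf e^-1; apply: filterS => j h.
  have e1 : 0 < e^-1 by rewrite invr_gt0.
  by rewrite ger0_norm // /t invf_plt ?posrE // (lt_trans e1 h).
have tn : \forall j \near U, enorm (t j *: v i2 j) = 1.
  have := v2inf 0; apply: filterS => j h.
  by rewrite enormZ ger0_norm // mulVf // gt_eqF.
have [q hq] : exists q, vcv U (fun j => t j *: v i2 j) q.
  by apply: (@vcv_bounded _ _ UU _ _ 1); apply: filterS tn => j ->.
(* The convergent sum, scaled by [t j] tending to 0, vanishes, so the normalized parts of nu and mu
   have opposite limits. *)
have hq3 : vcv U (fun j => t j *: v i3 j) (- q).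
  have := vcvB UU (vcvZ UU tcv hg) hq; rewrite scale0r sub0r.
  by apply: vcv_ext => j; rewrite scalerDr addrAC subrr add0r.
have qn : 1 <= enorm q.
  by apply: (cvgr_to_ge (vcv_norm UU hq)); apply: filterS tn => j ->.
(* The x-parts on the mu side stay in the unit ball before scaling. Hence [- q] is a normal with
   zero second component, which puts its first component in the coderivative at 0. *)
have qr : rsubmx (- q) = 0.
  apply: enorm_le_eps => e e0; apply: ltW; apply: le_lt_trans e0.
  apply: (ler_cvg_to (vcv_norm UU (vcv_rsubmx UU hq3)) tcv); near=> j.
  have -> : rsubmx (t j *: v i3 j) = t j *: rsubmx (v i3 j) by apply/rowP => i; rewrite !mxE.
  rewrite enormZ ger0_norm //; apply: ler_piMr => //.
  exact: (prox_subgrad_mu_norm K0 (p3 j)).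
have : [set w : 'rV[R]_(p + n) | subdiff_inf nuw wb (- w) /\
    coderiv_ball K xib xb (lsubmx w) /\ enorm (rsubmx w) <= 1] (- q).
  split; [rewrite opprK | split].
  - apply: (subdiff_inf_lim UU nufin w2 _ _ tcv hq); first by rewrite nu0; exact: a2.
      by near=> j.
    by near=> j; apply: p2.
  - exists 0; first by rewrite enorm0.
    rewrite /coderiv /= oppr0 -qr -pr_eta.
    by apply: (prox_subgrad_mu_lim UU Uoo Kcl K0 Kwb w3 a3 _ p3 hq3); near=> j.
  - by rewrite qr enorm0.
rewrite qual /= => /eqP; rewrite oppr_eq0 => /eqP q00.
by move: qn; rewrite q00 enorm0 ler10.
Unshelve. all: by end_near. Qed.
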